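(* Let $\mathfrak l\subset\mathfrak g$ be an inclusion of Lie algebras. Assume that $\mathfrak l$ has a nondegenerate splitting $\mathfrak l=\mathfrak k\oplus\mathfrak m$, and let $Z\in\wedge^3(\mathfrak g)^{\mathfrak g}$. For an $(\mathfrak l,\mathfrak g,Z)$-$r$-matrix $\rho$, set $$\sigma(\lambda):=r_{\mathfrak k}^{\mathfrak l}(\lambda)+\rho_{|\mathfrak k^*}(\lambda),\qquad \lambda\in\mathfrak k^*.$$ Then $\rho\mapsto\sigma$ is a map from the set of $(\mathfrak l,\mathfrak g,Z)$-$r$-matrices to the set of $(\mathfrak k,\mathfrak g,Z)$-$r$-matrices.
   Context: All Lie algebras are finite dimensional over $\mathbb C$. Nondegenerate splitting: $\mathfrak l=\mathfrak k\oplus\mathfrak m$ with $\mathfrak k$ a Lie subalgebra, $[\mathfrak k,\mathfrak m]\subset\mathfrak m$, and such that for generic $\lambda\in\mathfrak k^*$ the form $\omega(\lambda)\in\wedge^2(\mathfrak m)^*$, $\omega(\lambda)(x,y)=\lambda([x,y]_{\mathfrak k})$, is nondegenerate ($[x,y]_{\mathfrak k}$ is the projection to $\mathfrak k$ along $\mathfrak m$). Let $D_0=\det\omega\in S^{\dim\mathfrak m}(\mathfrak k)$. $r_{\mathfrak k}^{\mathfrak l}:=-\omega(\lambda)^{-1}\in\wedge^2(\mathfrak m)\otimes S^\cdot(\mathfrak k)[1/D_0]$, where for a nondegenerate $\omega\in\wedge^2(E^* )$, $\omega^{-1}\in\wedge^2(E)$ is the image of the tensor $\omega$ under (the tensor square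 of) the inverse of the isomorphism $E\to E^*$ induced by $\omega$. Equivalently, writing $r_{\mathfrak k}^{\mathfrak l}=\sum_i u_i\otimes v_i\otimes\ell_i$, one has $\sum_i[x,u_i]_{\mathfrak k}\,\ell_i\otimes v_i=1\otimes x$ in $S^\cdot(\mathfrak k)[1/D_0]\otimes\mathfrak m$ for all $x\in\mathfrak m$. A function $\mathfrak l^*\to\wedge^2(\mathfrak g)$ means an element of $\wedge^2(\mathfrak g)\otimes\widehat S^\cdot(\mathfrak l)[1/\Delta]$, where $\widehat S^\cdot$ is the completed symmetric algebra (formal functions) and $\Delta\in\widehat S^\cdot(\mathfrak l)$ is a nonzero element whose zero locus is $\mathfrak l$-invariant. The space $\mathfrak k^*$ is viewed inside $\mathfrak l^*$ as the annihilator of $\mathfrak m$, and $\rho_{|\mathfrak k^*}\in\wedge^2(\mathfrak g)\otimes\widehat S^\cdot(\mathfrak k)[1/\Delta_{|\mathfrak k^*}]$ is the restriction ($\Delta_{|\mathfrak k^*}\ne0$ since the zero locus of $\Delta$ is $\mathfrak l$-invariant). An $(\mathfrak l,\mathfrak g,Z)$-$r$-matrix is an $\mathfrak l$-invariant function $\rho:\mathfrak l^*\to\wedge^2(\mathfrak g)$ such that $\mathrm{CYB}(\rho)-\mathrm{Alt}(\mathrm d\rho)=Z$; likewise with $\mathfrak k$ in place of $\mathfrak l$. Here $\mathrm{CYB}(\rho)=[\rho^{1,2},\rho^{1,3}]+[\rho^{1,2},\rho^{2,3}]+[\rho^{1,3},\rho^{2,3}]$; $\mathrm d(x\otimes y\otimes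 z_1\cdots z_l)=\sum_i x\otimes y\otimes z_i\otimes z_1\cdots\check z_i\cdots z_l$ (the value lies in $\mathfrak g^{\otimes 3}\otimes$ functions, extended to localizations by the Leibniz rule); and $\mathrm{Alt}(\xi\otimes f)=(\xi+\xi^{2,3,1}+\xi^{3,1,2})\otimes f$ for $\xi\in\mathfrak g^{\otimes3}$ antisymmetric in two tensor factors. *)

(* Defs.v *)
From HB Require Import structures.
From mathcomp Require Import all_boot all_order all_algebra.
From mathcomp Require Import boolp classical_sets reals.
From mathcomp Require Import complex mpoly ring.

Set Implicit Arguments.
Unset Strict Implicit.
Unset Printing Implicit Defensive.

Import GRing.Theory.
Local Open Scope ring_scope.

Arguments FracField.tofrac {R} x.
Notation "x %:F" := (FracField.tofrac x) : ring_scope.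

HB.mixin Record Vector_isLie (F : fieldType) V of Vector F V := {
  lie : V -> V -> V;
  lie_linearl : forall y, linear (lie ^~ y);
  lie_linearr : forall x, linear (lie x);
  liexx : forall x, lie x x = 0;
  lie_jacobi : forall x y z,
    lie x (lie y z) + lie y (lie z x) + lie z (lie x y) = 0
}.

#[short(type="lieAlgType")]
HB.structure Definition LieAlgebra (F : fieldType) :=
  { V of Vector F V & Vector_isLie F V }.

Definition lie_stable (F : fieldType) (g : lieAlgType F) (U V W : {vspace g}) :=
  forall x y, x \in U -> y \in V -> lie x y \in W.

Definition lie_subalgebra (F : fieldType) (g : lieAlgType F) (h : {vspace g}) :=
  lie_stable h h h.

(** The completed symmetric algebra on n generators: the product over all
    degrees d of the spaces of homogeneous polynomials of degree d. *)

Section FormalSym.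
Context {F : fieldType} {n : nat}.

Record fsym := FSym {
  fcomp :> nat -> {mpoly F[n]};
  fcompP : forall d, fcomp d \is d.-homog
}.

Lemma fsymP (f g : fsym) : f =1 g <-> f = g.
Proof.
split=> [|-> //]; case: f g => [f fP] [g gP] /= /funext fg.
by move: gP; rewrite -fg => gP; congr FSym; apply: Prop_irrelevance.
Qed.

HB.instance Definition _ := gen_eqMixin fsym.
HB.instance Definition _ := gen_choiceMixin fsym.

Implicit Types f g h : fsym.

Definition fsym0 := FSym (fun d => dhomog0 F _ d).
Definition fsym_opp f := FSym (fun d => eq_ind_r is_true (fcompP f d) (dhomogN _ d (f d))).
Definition fsym_add f g := FSym (fun d => rpredD (fcompP f d) (fcompP g d)).

Definition fsym_of (p : {mpoly F[n]}) :=
  FSym (fun d => pihomogP [measure of mdeg] d p).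

Fact fsym_mul_homog f g d :
  \sum_(i < d.+1) f i * g (d - i)%N \is d.-homog.
Proof.
apply: rpred_sum => i _; have := dhomogM (fcompP f i) (fcompP g (d - i)).
by rewrite subnKC // -ltnS.
Qed.
Definition fsym_mul f g := FSym (fsym_mul_homog f g).

Let tr N f := \poly_(i < N) f i.

Let coef_tr N f d : (d < N)%N -> (tr N f)`_d = f d.
Proof. by move=> ltdN; rewrite coef_poly ltdN. Qed.

Let mulE N f g d : (d < N)%N -> fsym_mul f g d = (tr N f * tr N g)`_d.
Proof.
move=> ltdN; rewrite coefM; apply: eq_bigr => i _ /=.
have lid : (i <= d)%N by rewrite -ltnS.
by rewrite !coef_tr ?(leq_ltn_trans _ ltdN) // leq_subr.
Qed.

Fact fsym_addA : associative fsym_add.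
Proof. by move=> f g h; apply/fsymP => d /=; rewrite addrA. Qed.
Fact fsym_addC : commutative fsym_add.
Proof. by move=> f g; apply/fsymP => d /=; rewrite addrC. Qed.
Fact fsym_add0 : left_id fsym0 fsym_add.
Proof. by move=> f; apply/fsymP => d /=; rewrite add0r. Qed.
Fact fsym_addN : left_inverse fsym0 fsym_opp fsym_add.
Proof. by move=> f; apply/fsymP => d /=; rewrite addNr. Qed.

HB.instance Definition _ :=
  GRing.isZmodule.Build fsym fsym_addA fsym_addC fsym_add0 fsym_addN.

Lemma fsymD f g d : (f + g) d = f d + g d. Proof. by []. Qed.
Lemma fsymN f d : (- f) d = - f d. Proof. by []. Qed.
Lemma fsym0E d : (0 : fsym) d = 0. Proof. by []. Qed.

Fact fsym_mulC : commutative fsym_mul.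
Proof. by move=> f g; apply/fsymP => d; rewrite !(mulE _ _ (ltnSn d)) mulrC. Qed.

Let coef_trM N f g d : (d < N)%N -> (tr N (fsym_mul f g))`_d = (tr N f * tr N g)`_d.
Proof. by move=> ltdN; rewrite coef_tr // (mulE _ _ ltdN). Qed.

Let mulEl N f g h d : (d < N)%N ->
  fsym_mul (fsym_mul f g) h d = (tr N f * tr N g * tr N h)`_d.
Proof.
move=> ltdN; rewrite (mulE _ _ ltdN) coefM [RHS]coefM; apply: eq_bigr => i _.
by rewrite coef_trM // (leq_ltn_trans _ ltdN) // -ltnS.
Qed.

Fact fsym_mulA : associative fsym_mul.
Proof.
move=> f g h; apply/fsymP => d; rewrite (mulEl _ _ _ (ltnSn d)) fsym_mulC.
by rewrite (mulEl _ _ _ (ltnSn d)) mulrC mulrA.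
Qed.

Lemma fsym_of1 d : fsym_of 1 d = (d == 0%N)%:R.
Proof.
rewrite /=; case: eqP => [->|/eqP nd].
  by rewrite pihomog_dE // dhomog1.
by rewrite (pihomog_ne0 (d := 0%N)) ?dhomog1 // eq_sym.
Qed.

Fact fsym_mul1 : left_id (fsym_of 1) fsym_mul.
Proof.
move=> f; apply/fsymP => d /=; rewrite big_ord_recl [pihomog _ _ _]fsym_of1 /=.
rewrite mul1r subn0 big1 ?addr0 // => i _.
by rewrite [pihomog _ _ _]fsym_of1 /= mul0r.
Qed.

Fact fsym_mulDl : left_distributive fsym_mul +%R.
Proof.
move=> f g h; apply/fsymP => d; rewrite fsymD /= -big_split /=.
by apply: eq_bigr => i _; rewrite mulrDl.
Qed.

Fact fsym1_neq0 : fsym_of 1 != 0.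
Proof.
apply/eqP => /fsymP /(_ 0%N) /eqP; rewrite fsym_of1 /= oner_eq0.
by [].
Qed.

HB.instance Definition _ := GRing.Zmodule_isComNzRing.Build fsym
  fsym_mulA fsym_mulC fsym_mul1 fsym_mulDl fsym1_neq0.

Lemma fsymM f g d : (f * g) d = \sum_(i < d.+1) f i * g (d - i)%N.
Proof. by []. Qed.

Definition fsym_unit : pred fsym := fun f => `[< exists g, g * f = 1 >].
Definition fsym_inv f : fsym :=
  if pselect (exists g, g * f = 1) is left fP then projT1 (cid fP) else f.

Fact fsym_mulV : {in fsym_unit, left_inverse 1 fsym_inv *%R}.
Proof.
move=> f /asboolP fP; rewrite /fsym_inv; case: pselect => // fP'.
exact: projT2 (cid fP').
Qed.
Fact fsym_unitP f g : g * f = 1 -> fsym_unit f.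
Proof. by move=> gf; apply/asboolP; exists g. Qed.
Fact fsym_inv_out : {in [predC fsym_unit], fsym_inv =1 id}.
Proof.
by move=> f /asboolP fP; rewrite /fsym_inv; case: pselect.
Qed.

HB.instance Definition _ := GRing.ComNzRing_hasMulInverse.Build fsym
  fsym_mulV fsym_unitP fsym_inv_out.

Let low f : f != 0 -> exists a, f a != 0 /\ forall i, (i < a)%N -> f i = 0.
Proof.
move=> nf; have exf : exists a, f a != 0.
  apply: contrapT => /forallNP f0; case/eqP: nf; apply/fsymP => d /=.
  by apply/eqP/negPn/negP/f0.
case: (ex_minnP exf) => a fa amin; exists a; split=> // i ltia.
by apply/eqP; case: eqP => // /eqP /amin; rewrite leqNgt ltia.
Qed.

Fact fsym_idomain : GRing.integral_domain_axiom fsym.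
Proof.
move=> f g fg0; apply: contrapT => /negP /norP [/low] [a [fa fmin]].
move=> /low [b [gb gmin]].
move/fsymP: fg0 => /(_ (a + b)%N); rewrite fsymM fsym0E.
have lta : (a < (a + b).+1)%N by rewrite ltnS leq_addr.
rewrite (bigD1 (Ordinal lta)) //= addKn big1 ?addr0 => [|i nia].
  by move/eqP; rewrite mulf_eq0 (negPf fa) (negPf gb).
have [ltia|leai] := ltnP i a; first by rewrite fmin ?mul0r.
have ltai : (a < i)%N by rewrite ltn_neqAle leai andbT eq_sym.
have leiab : (i <= a + b)%N by rewrite -ltnS.
by rewrite gmin ?mulr0 // -(ltn_add2r i) subnK // [ltnRHS]addnC ltn_add2r.
Qed.

HB.instance Definition _ :=
  GRing.ComUnitRing_isIntegral.Build fsym fsym_idomain.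

Fact fsym_deriv_homog i f d : mderiv i (f d.+1) \is d.-homog.
Proof.
apply/dhomogP => m; rewrite mcoeff_msupp mcoeff_deriv => nz.
have /(dhomog_mf (fcompP f d.+1)) /= : (m + U_(i))%MM \in msupp (f d.+1).
  by rewrite mcoeff_msupp; apply: contraNneq nz => ->; rewrite mul0rn.
by rewrite mdegD mdeg1 addn1 => -[].
Qed.

Definition fsym_deriv i f := FSym (fsym_deriv_homog i f).

End FormalSym.
Arguments fsym F n : clear implicits.

Section Subst.
Context {F : fieldType} {n p : nat}.

Fact fsym_subst_homog (u : n.-tuple {mpoly F[p]}) :
  (forall i, tnth u i \is 1.-homog) -> forall (f : fsym F n) d,
  f d \mPo u \is d.-homog.
Proof.
move=> uh f d; rewrite comp_mpolyEX big_seq; apply: rpred_sum => m mf.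
apply: rpredZ; rewrite comp_mpolyX -(dhomog_mf (fcompP f d) mf) /= mdegE.
elim/big_ind2: _ => [|q a q' b qa qb|i _]; first exact: dhomog1.
  exact: dhomogM.
by have := dhomogMn (m i) (uh i); rewrite mul1n.
Qed.


Definition fsym_subst u uh f := FSym (@fsym_subst_homog u uh f).

End Subst.

(** Extension to the fraction field of a derivation, and of a morphism that
    need not be injective. *)

Section Fractions.
Context {A B : idomainType}.
Implicit Types (D : A -> A) (phi : A -> B) (q : {fraction A}).

Definition frac_der D q : {fraction A} :=
  let r := repr q in
  (D (\n_r) * \d_r - \n_r * D (\d_r))%:F / (\d_r ^+ 2)%:F.

(* Only meaningful at the q having a denominator not killed by phi, which is
   the localization of A on which phi extends; see frac_mapE. *)
Definition frac_map phi q : {fraction B} :=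
  xget 0 [set y | exists a b, [/\ phi b != 0, q = a%:F / b%:F
                                & y = (phi a)%:F / (phi b)%:F]]%classic.

Lemma frac_eq (R : idomainType) (a b c d : R) : b != 0 -> d != 0 ->
  (a%:F / b%:F == c%:F / d%:F) = (a * d == c * b).
Proof.
move=> b0 d0; rewrite GRing.eqr_div ?tofrac_eq0 //.
by rewrite -!tofracM tofrac_eq.
Qed.

Lemma frac_repr q : q = (\n_(repr q))%:F / (\d_(repr q))%:F.
Proof.
set r := repr q; have d0 : \d_r != 0 by apply: denom_ratioP.
apply: (canRL (mulfK _)); first by rewrite tofrac_eq0.
rewrite -[q in LHS]reprK -/r.
change (FracField.mul (\pi_(FracField.type A) r)%qT (\d_r)%:F = (\n_r)%:F).
rewrite !piE; apply/eqmodP; rewrite /= FracField.equivfE.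
rewrite /FracField.mulf !numden_Ratio ?mulf_neq0 ?oner_neq0 //.
by rewrite !mulr1 mulrC.
Qed.

Lemma frac_derE D a b : (forall c d, D (c * d) = D c * d + c * D d) -> b != 0 ->
  frac_der D (a%:F / b%:F) = (D a * b - a * D b)%:F / (b ^+ 2)%:F.
Proof.
move=> DM b0; rewrite /frac_der; set q := a%:F / b%:F; set r := repr q.
have d0 : \d_r != 0 by apply: denom_ratioP.
have /eqP : a%:F / b%:F = (\n_r)%:F / (\d_r)%:F by exact: (frac_repr q).
rewrite frac_eq // => /eqP e; have De : D (a * \d_r) = D (\n_r * b) by rewrite e.
move: De; rewrite !DM => De.
apply/eqP; rewrite frac_eq ?expf_neq0 //; apply/eqP.
have -> : (D \n_r * \d_r - \n_r * D \d_r) * b ^+ 2 =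
  b * \d_r * (D \n_r * b + \n_r * D b) - b * \d_r * (\n_r * D b)
    - b * D \d_r * (\n_r * b) by ring.
by rewrite -De -e; ring: e.
Qed.

Lemma frac_mapE (phi : {rmorphism A -> B}) a b : phi b != 0 ->
  frac_map phi (a%:F / b%:F) = (phi a)%:F / (phi b)%:F.
Proof.
move=> b0; rewrite /frac_map.
case: xgetP => [y _ [c [d [d0 /eqP e ->]]]|/(_ ((phi a)%:F / (phi b)%:F)) []].
  have nz z : phi z != 0 -> z != 0 by apply: contraNneq => ->; rewrite rmorph0.
  apply/eqP; rewrite frac_eq // -!rmorphM; move: e.
  by rewrite frac_eq ?nz // => /eqP ->.
by exists a, b.
Qed.

End Fractions.

(** Formal functions on the dual of a subspace h of g, in the coordinates
    given by vbasis h *)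

Section FormalFunctions.
Context {F : fieldType} {g : lieAlgType F}.
Implicit Types (h l k m : {vspace g}) (x y v : g).

Definition ffunc h := fsym F (\dim h).

Definition linp h v : {mpoly F[\dim h]} :=
  \sum_i coord (vbasis h) i v *: 'X_i.

Fact linp_homog h v : linp h v \is 1.-homog.
Proof.
apply: rpred_sum => i _; apply: rpredZ; rewrite dhomogX.
by rewrite /= mdeg1.
Qed.

Definition flin h v : ffunc h := fsym_of (linp h v).

Definition fconst h (c : F) : {fraction (ffunc h)} := (fsym_of c%:MP)%:F.

(* The derivation of the completed symmetric algebra extending ad x. *)
Definition fad h x (f : ffunc h) : ffunc h :=
  \sum_(i < \dim h) flin h (lie x (vbasis h)`_i) * fsym_deriv i f.
Arguments fad : clear implicits.

(* The closed subset Delta = 0 is invariant when the ideal of the functions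
   vanishing on it, the radical of (Delta), is stable. *)
Definition vanishing_on_zeros h (Delta f : ffunc h) :=
  exists n u, f ^+ n = u * Delta.

Definition zero_locus_invariant h (Delta : ffunc h) :=
  forall x, x \in h -> forall f : ffunc h,
    vanishing_on_zeros Delta f -> vanishing_on_zeros Delta (fad h x f).
Arguments zero_locus_invariant : clear implicits.

(* Restriction of functions from the dual of l = k + m to the annihilator of m:
   an element of l is replaced by its projection to k along m. *)
Fact fres_homog l k m i :
  tnth [tuple linp k (daddv_pi k m (vbasis l)`_i) | i < \dim l] i \is 1.-homog.
Proof. by rewrite tnth_mktuple linp_homog. Qed.

Definition fres l k m (f : ffunc l) : ffunc k :=
  fsym_subst (@fres_homog l k m) f.
Arguments fres : clear implicits.

(** Tensors, in the coordinates given by vbasis {:g} *)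

Local Notation N := (\dim {:g}).
Local Notation E i := (vbasis {:g})`_i.

Definition tensor3 (K : nzRingType) := {ffun 'I_N * 'I_N * 'I_N -> K^o}.

Definition tens2 x y : 'M[F]_N :=
  \matrix_(i, j) (coord (vbasis {:g}) i x * coord (vbasis {:g}) j y).

Definition tens3 x y z : tensor3 F :=
  [ffun p => coord (vbasis {:g}) p.1.1 x * coord (vbasis {:g}) p.1.2 y
             * coord (vbasis {:g}) p.2 z].

Definition ext2 h (t : 'M[F]_N) : 'M[{fraction (ffunc h)}]_N :=
  map_mx (fconst h) t.

Definition ext3 h (t : tensor3 F) : tensor3 {fraction (ffunc h)} :=
  [ffun p => fconst h (t p)].

Definition wedge3_invariant (Z : tensor3 F) :=
  [/\ forall i j r, Z (j, i, r) = - Z (i, j, r),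
      forall i j r, Z (i, r, j) = - Z (i, j, r)
    & forall x, \sum_(i < N) \sum_(j < N) \sum_(r < N) Z (i, j, r) *:
        (tens3 (lie x (E i)) (E j) (E r) + tens3 (E i) (lie x (E j)) (E r)
         + tens3 (E i) (E j) (lie x (E r))) = 0].

Section RMatrix.
Variable h : {vspace g}.
Local Notation K := {fraction (ffunc h)}.
Implicit Type rho : 'M[K]_N.

(* An antisymmetric tensor over the localization at Delta, viewed inside the
   fraction field; this matches exterior powers in characteristic 0. *)
Definition wedge2_function rho :=
  rho^T = - rho /\
  exists Delta : ffunc h, [/\ Delta != 0, zero_locus_invariant h Delta
    & forall i j, exists a n, rho i j = a%:F / (Delta ^+ n)%:F].

Definition invariant_function rho :=
  forall x, x \in h -> \sum_(i < N) \sum_(j < N)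
    (frac_der (fad h x) (rho i j) *: ext2 h (tens2 (E i) (E j))
     + rho i j *: ext2 h (tens2 (lie x (E i)) (E j)
                          + tens2 (E i) (lie x (E j)))) = 0.

Definition CYB rho : tensor3 K :=
  \sum_(i < N) \sum_(j < N) \sum_(r < N) \sum_(s < N) (rho i j * rho r s) *: ext3 h
    (tens3 (lie (E i) (E r)) (E j) (E s) + tens3 (E i) (lie (E j) (E r)) (E s)
     + tens3 (E i) (E r) (lie (E j) (E s))).

Definition dtens rho : tensor3 K :=
  \sum_(i < N) \sum_(j < N) \sum_(a < \dim h) frac_der (fsym_deriv a) (rho i j) *:
    ext3 h (tens3 (E i) (E j) (vbasis h)`_a).

Definition Alt (xi : tensor3 K) : tensor3 K :=
  [ffun p => xi p + xi (p.1.2, p.2, p.1.1) + xi (p.2, p.1.1, p.1.2)].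

Definition is_rmatrix (Z : tensor3 F) rho :=
  [/\ wedge2_function rho, invariant_function rho
    & CYB rho - Alt (dtens rho) = ext3 h Z].

End RMatrix.

Definition omega k m (lam : 'Hom(subvs_of k, F^o)) x y : F :=
  lam (vsproj k (daddv_pi k m (lie x y))).

(* A property holds for generic lam when it holds on the complement of the zero
   locus of some nonzero polynomial P on k^*. *)
Definition nondegenerate_splitting l k m :=
  [/\ (k + m = l)%VS, (k :&: m = 0)%VS, lie_subalgebra k, lie_stable k m m
    & exists2 P : {mpoly F[\dim k]}, P != 0 &
      forall lam : 'Hom(subvs_of k, F^o),
        P.@[fun i => lam (vsproj k (vbasis k)`_i)] != 0 ->
        forall x, x \in m -> (forall y, y \in m -> omega m lam x y = 0) -> x = 0].

(* The tautological omega over k^*, as a matrix of linear functions; its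
   determinant is D_0, nonzero when the splitting is nondegenerate. *)
Definition omega_mx k m : 'M[{fraction (ffunc k)}]_(\dim m) :=
  \matrix_(a, b)
    (flin k (daddv_pi k m (lie (vbasis m)`_a (vbasis m)`_b)))%:F.

(* The image of W under the tensor square of the inverse of the map E -> E^*
   that W induces; this inverse has matrix invmx W acting on row vectors. *)
Definition biv_inv (K : fieldType) n (W : 'M[K]_n) : 'M[K]_n :=
  (invmx W)^T *m W *m invmx W.

Definition r_splitting k m : 'M[{fraction (ffunc k)}]_N :=
  - \sum_(a < \dim m) \sum_(b < \dim m) biv_inv (omega_mx k m) a b *:
      ext2 k (tens2 (vbasis m)`_a (vbasis m)`_b).

Definition restrict l k m (rho : 'M[{fraction (ffunc l)}]_N) :
    'M[{fraction (ffunc k)}]_N :=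
  map_mx (frac_map (fres l k m)) rho.
Arguments restrict : clear implicits.

Definition sigma l k m (rho : 'M[{fraction (ffunc l)}]_N) :=
  r_splitting k m + restrict l k m rho.

End FormalFunctions.

Arguments tensor3 {F} g K.
Arguments fad {F g} h x f.
Arguments zero_locus_invariant {F g} h Delta.
Arguments fres {F g} l k m f.
Arguments restrict {F g} l k m rho.
Arguments is_rmatrix {F g} h Z rho.
Arguments sigma {F g} l k m rho.

(* Main.v *)
(** Write W for the matrix of omega on m, with entries the linear functions
    [e_a, e_b]_k, and P for its inverse, so that r_k^l = sum P_ab e_a (x) e_b.

    For an antisymmetric rho with rows R_p, the (p, q, s) coordinate of CYB(rho)
    is the cyclic sum of [R_p, R_q]_s, and Alt(d rho) is a cyclic sum as well.
    The k-component of CYB(r_k^l) is Alt(d r_k^l) because dP = - P dW P, and its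
    m-component vanishes by the Jacobi identity.  Invariance of rho under x in m,
    restricted to k^*, reads sum_b omega(x, e_b) (d_b rho)|k^* = - ad_x rho|k^*;
    inverting W, the derivatives of rho transverse to k^* cancel the mixed terms
    [r_k^l, rho|k^*].

    For the denominators, let J be the radical ideal of the zero locus of Delta.
    If Delta vanished on k^*, so would J.  Let n be maximal such that J vanishes to
    order n along k^*; stability of J under ad m and invertibility of W show that
    J vanishes to order n + 1, so J = 0. *)
From HB Require Import structures.
From mathcomp Require Import all_boot all_order all_algebra.
From mathcomp Require Import perm.
From mathcomp Require Import boolp classical_sets reals.
From mathcomp Require Import complex mpoly ring.
Require Import Defs.

Set Implicit Arguments.
Unset Strict Implicit.
Unset Printing Implicit Defensive.

Import GRing.Theory.
Local Open Scope ring_scope.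

(** * Derivations, radicals and fractions *)

(** Restriction is only partially defined on fractions, so identities for [rho] are transported by
    the relation [specializes]: a fraction has at most one specialization, and both sides of an
    identity specialize. Derivatives of [rho] transverse to the dual of [k] have to be taken before
    restricting and cannot be read off the restriction; only invariance under [m] determines them.
    To use omega on the dual of [l], its matrix is lifted with the same entries, read as linear
    functions on the dual of [l]. The lift is constant in the transverse directions, so dividing by
    its determinant preserves orders of vanishing. The denominator of [sigma] is the determinant of
    omega times the restricted [Delta]. Invariance of its zero locus concerns a radical, whose
    stability has to be deduced from the iterated derivatives of a generator; this uses division by
    integers. The determinant is handled by semi-invariance: [ad x] multiplies it by twice the trace
    of [ad x] on [m]. *)

Definition derivation (A : comNzRingType) (D : A -> A) :=
  (forall f g, D (f + g) = D f + D g) /\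
  (forall f g, D (f * g) = D f * g + f * D g).

Section Derivations.
Variables (A : comNzRingType) (D : A -> A).
Hypothesis derD : derivation D.

Lemma derD_add f g : D (f + g) = D f + D g. Proof. exact: derD.1. Qed.

Lemma der_mul f g : D (f * g) = D f * g + f * D g. Proof. exact: derD.2. Qed.

Lemma der0 : D 0 = 0.
Proof. by apply: (addrI (D 0)); rewrite -derD_add !addr0. Qed.

Lemma derN f : D (- f) = - D f.
Proof. by apply: (addrI (D f)); rewrite -derD_add !subrr der0. Qed.

Lemma der1 : D 1 = 0.
Proof. by apply: (addrI (D 1)); rewrite -{3}(mulr1 1) der_mul mul1r mulr1 addr0. Qed.

Lemma der_sum (I : Type) (r : seq I) (P : pred I) (f : I -> A) :
  D (\sum_(i <- r | P i) f i) = \sum_(i <- r | P i) D (f i).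
Proof. exact: (big_morph D derD_add der0). Qed.

Lemma der_prod (I : finType) (f : I -> A) :
  D (\prod_i f i) = \sum_i D (f i) * \prod_(j | j != i) f j.
Proof.
pose K (P : pred I) := D (\prod_(i | P i) f i) =
  \sum_(i | P i) D (f i) * \prod_(j | P j && (j != i)) f j.
suff H (n : nat) (P : pred I) : #|P| = n -> K P by apply: (H #|I|).
elim: n P => [|n IH] P cP.
  have P0 : P =1 pred0 by apply/fintype.card0_eq.
  by rewrite /K !big_pred0 // der1.
have /card_gt0P [i Pi] : (0 < #|P|)%N by rewrite cP.
have cP' : #|[pred j | P j && (j != i)]| = n.
  move: cP; rewrite (cardD1 i P) (_ : i \in P) ?add1n // => -[<-].
  by apply: eq_card => j; rewrite !inE andbC.
have {}Pi : P i by []; rewrite /K (bigD1 i) //= der_mul [D (\prod_(_ | _ && _) _)](IH _ cP').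
rewrite [RHS](bigD1 i) //=; congr (_ + _); rewrite mulr_sumr.
apply: eq_bigr => j /andP [Pj ji]; rewrite mulrCA; congr (_ * _).
rewrite [RHS](bigD1 i) /=; last by rewrite Pi eq_sym.
by congr (_ * _); apply: eq_bigl => h; rewrite -!andbA; congr (_ && _); rewrite andbC.
Qed.

Lemma der_det n (W : 'M[A]_n) :
  D (\det W) = \sum_i \sum_j D (W i j) * cofactor W i j.
Proof.
have sgnD (s : 'S_n) : D ((-1) ^+ s) = 0 by case: (odd_perm s); rewrite ?derN der1 ?oppr0.
pose Wi i := \matrix_(i', j) (if i' == i then D (W i' j) else W i' j).
transitivity (\sum_i \det (Wi i)).
  rewrite /determinant der_sum exchange_big /=; apply: eq_bigr => s _.
  rewrite der_mul sgnD mul0r add0r der_prod mulr_sumr; apply: eq_bigr => i _.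
  rewrite [in RHS](bigD1 i) //= mxE eqxx; do 2!congr (_ * _).
  by apply: eq_bigr => j /negPf ji; rewrite mxE ji.
apply: eq_bigr => i _; rewrite (expand_det_row _ i); apply: eq_bigr => j _.
rewrite mxE eqxx; congr (_ * (_ * \det _)).
by apply/matrixP => a b; rewrite !mxE eq_sym (negPf (neq_lift _ _)).
Qed.

Lemma der_mulmx m n p (U : 'M[A]_(m, n)) (V : 'M[A]_(n, p)) :
  map_mx D (U *m V) = map_mx D U *m V + U *m map_mx D V.
Proof.
apply/matrixP => i j; rewrite !mxE der_sum -big_split /=.
by apply: eq_bigr => h _; rewrite der_mul !mxE.
Qed.

(** Jacobi's formula for an infinitesimal change of basis of a bilinear form: each side of the
    congruence contributes [\tr C]. *)
Lemma der_det_congr n (W C : 'M[A]_n) :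
  map_mx D W = C^T *m W + W *m C -> D (\det W) = \tr C *+ 2 * \det W.
Proof.
move=> DW; have -> : D (\det W) = \tr (map_mx D W *m \adj W).
  rewrite der_det /mxtrace; apply: eq_bigr => i _; rewrite !mxE.
  by apply: eq_bigr => j _; rewrite !mxE.
rewrite DW mulmxDl mxtraceD -!mulmxA mul_mx_adj [\tr (W *m _)]mxtrace_mulC.
by rewrite -mulmxA mul_adj_mx !mul_mx_scalar !mxtraceZ mxtrace_tr -mulrDr mulrC mulr2n.
Qed.

Lemma der_exp f n : D (f ^+ n.+1) = n.+1%:R * (f ^+ n * D f).
Proof.
elim: n => [|n IH]; first by rewrite expr1 expr0 !mul1r.
rewrite exprS der_mul IH -[in RHS]nat1r exprS; ring.
Qed.

End Derivations.

(** [vanishing_on_zeros] over an arbitrary commutative ring; for formal functions the two are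
    convertible. *)
Definition in_radical (A : comNzRingType) (d f : A) := exists n u, f ^+ n = u * d.

Section Radicals.
Variable A : idomainType.
Implicit Types (d f g : A) (D : A -> A).

Lemma radicalM d f g : in_radical d f -> in_radical d (g * f).
Proof. by move=> [n [u e]]; exists n, (g ^+ n * u); rewrite exprMn e mulrA. Qed.

Lemma radicalD d f g : in_radical d f -> in_radical d g -> in_radical d (f + g).
Proof.
move=> [n [u e]] [p [v e']].
(* In the binomial expansion of exponent [n + p], either [f] has exponent at least [n] or [g] has
   exponent at least [p]. *)
have E i : exists w, f ^+ i * g ^+ (n + p - i) = w * d.
  have [ni|ni] := leqP n i.
    by exists (f ^+ (i - n) * g ^+ (n + p - i) * u); rewrite -{1}(subnK ni) exprD e; ring.
  exists (f ^+ i * g ^+ (n - i) * v).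
  by rewrite addnC -addnBA 1?ltnW // exprD e'; ring.
exists (n + p)%N; rewrite addrC exprDn.
elim/big_ind: _ => [|a b [u' ->] [v' ->]|i _].
- by exists 0; rewrite mul0r.
- by exists (u' + v'); rewrite mulrDl.
by have [w ew] := E i; exists (w *+ 'C(n + p, i)); rewrite mulrC ew mulrnAl.
Qed.

Lemma radical_exp d f n : in_radical d (f ^+ n) -> in_radical d f.
Proof. by move=> [p [u e]]; exists (n * p)%N, u; rewrite exprM. Qed.

Lemma radical_gen d : in_radical d d.
Proof. by exists 1%N, 1; rewrite expr1 mul1r. Qed.

Lemma radical_prod d d' f :
  in_radical (d * d') f <-> in_radical d f /\ in_radical d' f.
Proof.
split=> [[n [u e]]|[[n [u e]] [p [v e']]]].
  by split; exists n; [exists (u * d') | exists (u * d)]; rewrite e; ring.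
by exists (n + p)%N, (u * v); rewrite exprD e e'; ring.
Qed.

(* The elements all of whose iterated derivatives lie in the radical form a
   D-stable ideal with the same radical as d, and in characteristic 0 the
   radical of a D-stable ideal is D-stable. *)
Lemma radical_stable d D : derivation D ->
  (forall n, (n.+1)%:R \is a @GRing.unit A) ->
  (forall i, in_radical d (iter i D d)) ->
  forall f, in_radical d f -> in_radical d (D f).
Proof.
move=> derD unitn stab.
pose J f := forall i, in_radical d (iter i D f).
have JD f g : J f -> J g -> J (f + g).
  move=> Jf Jg i; suff -> : iter i D (f + g) = iter i D f + iter i D g by apply: radicalD.
  by elim: i => //= i ->; rewrite derD_add.
have Jder f : J f -> J (D f) by move=> Jf i; rewrite -iterSr; apply: Jf.
have JM f g : J f -> J (g * f).
  move=> Jf i; elim: i f g Jf => [|i IH] f g Jf; first by apply: radicalM; apply: (Jf 0).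
  have -> : iter i.+1 D (g * f) = iter i D (D g * f) + iter i D (g * D f).
    rewrite iterSr der_mul //; elim: i {IH} (D g * f) (g * D f) => //= i IH a b.
    by rewrite IH derD_add.
  by apply: radicalD; apply: IH => //; apply: Jder.
have Jrad f : J f -> in_radical d f by move=> /(_ 0).
move=> f [n [u e]].
suff [N JN] : exists N, J (f ^+ 0 * D f ^+ N).
  by apply: (@radical_exp _ _ N); have := Jrad _ JN; rewrite expr0 mul1r.
have : exists N, J (f ^+ n * D f ^+ N).
  by exists 0; rewrite expr0 mulr1 e; apply: JM => i; apply: stab.
(* Powers of [f] are traded for powers of [D f], two at a time: differentiate
   [f ^+ n.+1 * D f ^+ N], multiply by [D f], subtract the term in [D (D f)], which is a multiple of
   the given element, and divide by [n.+1]. *)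
elim: n {u e} => // n IH [N JN]; apply: IH; exists N.+2.
case: N JN => [|N] JN.
  have := Jder _ JN; rewrite expr0 mulr1 (der_exp derD) => J1.
  have := JM _ (D f * (n.+1)%:R^-1) J1.
  suff -> : D f / n.+1%:R * (n.+1%:R * (f ^+ n * D f)) = f ^+ n * D f ^+ 2 by [].
  rewrite mulrA (divrK (unitn n)) expr2; ring.
have J1 : J (D f * D (f ^+ n.+1 * D f ^+ N.+1) - N.+1%:R * D (D f) * (f ^+ n.+1 * D f ^+ N.+1)).
  by rewrite -mulNr; apply: JD; apply: JM => //; apply: Jder.
have := JM _ (n.+1)%:R^-1 J1.
rewrite (der_mul derD) !(der_exp derD) => J2.
suff -> : f ^+ n * D f ^+ N.+3 = n.+1%:R^-1 * (n.+1%:R * (f ^+ n * D f ^+ N.+3)).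
  by congr J: J2; congr (_ * _); rewrite !exprS; ring.
by rewrite mulKr // unitn.
Qed.

End Radicals.

Section FracDer.
Variable A : idomainType.
Implicit Types (D : A -> A) (q : {fraction A}).

Lemma frac_repr_exists q : exists a b, b != 0 /\ q = a%:F / b%:F.
Proof.
exists (\n_(repr q)), (\d_(repr q)); split; first exact: denom_ratioP.
exact: frac_repr.
Qed.

Lemma frac_der_derivation D : derivation D -> derivation (frac_der D).
Proof.
move=> derD; have DM := der_mul derD; split=> q q'.
  have [a [b [b0 ->]]] := frac_repr_exists q.
  have [c [d [d0 ->]]] := frac_repr_exists q'.
  have -> : a%:F / b%:F + c%:F / d%:F = (a * d + c * b)%:F / (b * d)%:F.
    by rewrite addf_div ?tofrac_eq0 // tofracD !tofracM.
  rewrite !frac_derE ?mulf_neq0 // addf_div ?tofrac_eq0 ?expf_neq0 //.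
  rewrite -!tofracM -tofracD; apply/eqP.
  rewrite frac_eq ?mulf_neq0 ?expf_neq0 ?mulf_neq0 //; apply/eqP.
  rewrite (derD_add derD) !DM; ring.
have [a [b [b0 ->]]] := frac_repr_exists q.
have [c [d [d0 ->]]] := frac_repr_exists q'.
rewrite mulf_div -!tofracM !frac_derE ?mulf_neq0 // !mulf_div -!tofracM.
rewrite addf_div ?tofrac_eq0 ?mulf_neq0 ?expf_neq0 //.
rewrite -!tofracM -tofracD; apply/eqP.
rewrite frac_eq ?mulf_neq0 ?expf_neq0 ?mulf_neq0 //; apply/eqP.
rewrite !DM; ring.
Qed.

Lemma frac_der_tofrac D a : derivation D -> frac_der D a%:F = (D a)%:F.
Proof.
move=> derD; rewrite -[a%:F]divr1 -tofrac1 frac_derE ?oner_eq0 //.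
  by rewrite (der1 derD) mulr1 mulr0 subr0 expr1n tofrac1 divr1.
exact: der_mul derD.
Qed.

(** Used to expand [fad] and directional derivatives of a fraction in partial derivatives, which are
    then specialized one by one. *)
Lemma frac_der_lincomb (I : finType) (c : I -> A) (E : I -> A -> A) D q :
  derivation D -> (forall i, derivation (E i)) ->
  (forall a, D a = \sum_i c i * E i a) ->
  frac_der D q = \sum_i (c i)%:F * frac_der (E i) q.
Proof.
move=> derD derE DE; have [a [b [b0 ->]]] := frac_repr_exists q.
rewrite frac_derE //; last exact: der_mul derD.
under eq_bigr => i _ do
  rewrite (frac_derE _ (der_mul (derE i)) b0) mulrA -tofracM.
rewrite -mulr_suml; congr (_ / _); rewrite !DE.
rewrite mulr_suml mulr_sumr -sumrB rmorph_sum; apply: eq_bigr => i _.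
by congr (_%:F); ring.
Qed.

End FracDer.

(* [specializes phi q y]: the fraction q lies in the localization on which
   phi extends, and y is its image. *)
Definition specializes (A B : idomainType) (phi : A -> B)
    (q : {fraction A}) (y : {fraction B}) :=
  exists a b, [/\ phi b != 0, q = a%:F / b%:F & y = (phi a)%:F / (phi b)%:F].

Section Specialization.
Variables (A B : idomainType) (phi : {rmorphism A -> B}).
Implicit Types (q : {fraction A}) (y : {fraction B}).

Let nz b : phi b != 0 -> b != 0.
Proof. by apply: contraNneq => ->; rewrite rmorph0. Qed.

(** The cross-multiplied equality survives [phi], and the denominators have nonzero images;
    injectivity of [phi] is not involved. *)
Lemma specializes_unique q y y' :
  specializes phi q y -> specializes phi q y' -> y = y'.
Proof.
move=> [a [b [b0 -> ->]]] [c [d [d0 /eqP e ->]]]; apply/eqP.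
rewrite frac_eq // -!rmorphM; move: e.
by rewrite frac_eq ?nz // => /eqP ->.
Qed.

Lemma specializes_tofrac a : specializes phi a%:F (phi a)%:F.
Proof. by exists a, 1; rewrite rmorph1 oner_eq0 tofrac1 !divr1. Qed.

Lemma specializes0 : specializes phi 0 0.
Proof. by have := specializes_tofrac 0; rewrite !rmorph0. Qed.

Lemma specializesD q q' y y' : specializes phi q y -> specializes phi q' y' ->
  specializes phi (q + q') (y + y').
Proof.
move=> [a [b [b0 -> ->]]] [c [d [d0 -> ->]]].
exists (a * d + c * b), (b * d); rewrite rmorphM mulf_neq0 //.
by rewrite !addf_div ?tofrac_eq0 ?nz // !rmorphD !rmorphM.
Qed.

Lemma specializesM q q' y y' : specializes phi q y -> specializes phi q' y' ->
  specializes phi (q * q') (y * y').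
Proof.
move=> [a [b [b0 -> ->]]] [c [d [d0 -> ->]]].
exists (a * c), (b * d); rewrite rmorphM mulf_neq0 //.
by rewrite !mulf_div !rmorphM.
Qed.

Lemma specializesN q y : specializes phi q y -> specializes phi (- q) (- y).
Proof.
by move=> [a [b [b0 -> ->]]]; exists (- a), b; rewrite !rmorphN !mulNr.
Qed.

Lemma specializes_sum (I : Type) (r : seq I) (P : pred I) (f : I -> {fraction A})
    (g : I -> {fraction B}) : (forall i, P i -> specializes phi (f i) (g i)) ->
  specializes phi (\sum_(i <- r | P i) f i) (\sum_(i <- r | P i) g i).
Proof.
move=> fg; elim/big_ind2: _ => [|? ? ? ?|i /fg] //; first exact: specializes0.
exact: specializesD.
Qed.

(** The quotient rule only squares the denominator, so the derivative stays in the localization even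
    when [D] does not preserve the kernel of [phi]. Its value then depends on [q], not only on
    [y]. *)
Lemma specializes_der_exists D q y : derivation D -> specializes phi q y ->
  specializes phi (frac_der D q) (frac_map phi (frac_der D q)).
Proof.
move=> derD [a [b [b0 -> _]]].
rewrite frac_derE ?nz //; last exact: der_mul derD.
have b2 : phi (b ^+ 2) != 0 by rewrite rmorphXn expf_neq0.
by rewrite frac_mapE //; exists (D a * b - a * D b), (b ^+ 2).
Qed.

Lemma specializes_der D D' q y : derivation D -> derivation D' ->
  (forall a, phi (D a) = D' (phi a)) -> specializes phi q y ->
  specializes phi (frac_der D q) (frac_der D' y).
Proof.
move=> derD derD' phiD [a [b [b0 -> ->]]].
rewrite (frac_derE _ (der_mul derD)) ?nz // (frac_derE _ (der_mul derD')) //.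
exists (D a * b - a * D b), (b ^+ 2); split=> //.
  by rewrite rmorphXn expf_neq0.
have -> : phi (D a * b - a * D b) = D' (phi a) * phi b - phi a * D' (phi b).
  by rewrite rmorphB !rmorphM !phiD.
by rewrite -[phi b ^+ 2]rmorphXn.
Qed.

End Specialization.

(** * Formal functions *)

Lemma dhomogC (R : nzRingType) n (c : R) : (c%:MP : {mpoly R[n]}) \is 0.-homog.
Proof. by rewrite -[c%:MP]mulr1 mul_mpolyC; apply/dhomogZ/dhomog1. Qed.

Lemma dhomog0E (R : nzRingType) n (p : {mpoly R[n]}) : p \is 0.-homog -> p = (p@_0)%:MP.
Proof.
move=> hp; apply/mpolyP => m; rewrite mcoeffC eq_sym.
have [->|m0] := eqVneq m 0%MM; first by rewrite mulr1.
by rewrite mulr0 (dhomog_nemf_coeff hp) //= mdeg_eq0.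
Qed.

Section FormalSymTheory.
Context {F : fieldType} {n : nat}.
Local Notation S := (Defs.fsym F n).
Implicit Types (f g : S) (p q : {mpoly F[n]}).

Lemma fsym_ofD p q : fsym_of (p + q) = fsym_of p + fsym_of q :> S.
Proof. by apply/fsymP => d; rewrite fsymD /= pihomogD. Qed.

Lemma fsym_of0 : fsym_of 0 = 0 :> S.
Proof. by apply/fsymP => d; rewrite fsym0E /= pihomog0. Qed.

Lemma fsym_ofM p q : fsym_of (p * q) = fsym_of p * fsym_of q :> S.
Proof.
elim/mpolyind: p => [|c m p _ _ IH]; first by rewrite mul0r fsym_of0 mul0r.
rewrite mulrDl !fsym_ofD mulrDl IH; congr (_ + _) => {p IH}.
elim/mpolyind: q => [|c' m' q _ _ IH]; first by rewrite mulr0 fsym_of0 mulr0.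
rewrite mulrDr !fsym_ofD mulrDr IH; congr (_ + _) => {q IH}.
apply/fsymP => d; rewrite fsymM /= -scalerAl -scalerAr -mpolyXD.
under eq_bigr do rewrite !linearZ /= !pihomogX /=.
rewrite !linearZ /= pihomogX /= mdegD.
have [md|dm] := leqP (mdeg m) d.
  have ltm : (mdeg m < d.+1)%N by [].
  rewrite (bigD1 (Ordinal ltm)) //= eqxx big1 ?addr0 => [|i /negPf im].
    rewrite -[in RHS](eqn_add2l (mdeg m)) subnKC //.
    by case: ifP; rewrite ?scaler0 ?mulr0 // mpolyXD -scalerAl -scalerAr.
  by rewrite -[mdeg m == i]eq_sym -[i == mdeg m :> nat]/(i == Ordinal ltm) im scaler0 mul0r.
rewrite gtn_eqF ?scaler0; last by rewrite ltn_addr.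
rewrite big1 // => i _; rewrite gtn_eqF ?scaler0 ?mul0r //.
by rewrite (leq_ltn_trans _ dm) // -ltnS.
Qed.

Lemma fsym_of_zmod_morphism : zmod_morphism (fsym_of : {mpoly F[n]} -> S).
Proof.
move=> p q; rewrite fsym_ofD; congr (_ + _).
by apply/fsymP => d; rewrite fsymN /= pihomogN.
Qed.

Lemma fsym_of_monoid_morphism : monoid_morphism (fsym_of : {mpoly F[n]} -> S).
Proof. by split=> [|p q] //; apply: fsym_ofM. Qed.

HB.instance Definition _ :=
  GRing.isZmodMorphism.Build {mpoly F[n]} S fsym_of fsym_of_zmod_morphism.
HB.instance Definition _ :=
  GRing.isMonoidMorphism.Build {mpoly F[n]} S fsym_of fsym_of_monoid_morphism.

Lemma fsym_of_inj : injective (fsym_of : {mpoly F[n]} -> S).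
Proof.
move=> p q /fsymP e; have {}e d : pihomog mdeg d p = pihomog mdeg d q by apply: e.
pose s := maxn (mmeasure mdeg p) (mmeasure mdeg q).
rewrite (pihomog_partitionE (leq_maxl _ _ : _ <= s)%N).
rewrite [RHS](pihomog_partitionE (leq_maxr _ _ : _ <= s)%N).
by apply: eq_bigr => d _; apply: e.
Qed.

Lemma fsym_sumE (I : Type) (r : seq I) (P : pred I) (h : I -> S) d :
  (\sum_(i <- r | P i) h i) d = \sum_(i <- r | P i) h i d.
Proof. by elim/big_rec2: _ => // i a b _ <-. Qed.

Lemma fsym_ofCM c f d : (fsym_of c%:MP * f) d = c%:MP * f d.
Proof.
rewrite fsymM big_ord_recl subn0 big1 ?addr0 => [|i _].
  by rewrite /= pihomog_dE // dhomogC.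
by rewrite /= (pihomog_ne0 (d := 0)) ?dhomogC // mul0r.
Qed.

Lemma fsym_deriv_derivation (i : 'I_n) : derivation (fsym_deriv i : S -> S).
Proof.
split=> f g; first by apply/fsymP => d; rewrite fsymD /= mderivD.
apply/fsymP => d; rewrite fsymD !fsymM /= linear_sum /=.
under eq_bigr do rewrite mderivM.
rewrite big_split /=; congr (_ + _).
  (* In degree [d.+1] there is one summand too many, the first here and the last for [g]; it
     differentiates a component of degree 0, which is constant. *)
  rewrite big_ord_recl /= (dhomog0E (fcompP f 0)) mderivC mul0r add0r.
  by apply: eq_bigr => j _; rewrite subSS.
rewrite big_ord_recr /= subnn (dhomog0E (fcompP g 0)) mderivC mulr0 addr0.
by apply: eq_bigr => j _; rewrite subSn // -ltnS.
Qed.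

Lemma fsym_deriv_comm (i j : 'I_n) f :
  fsym_deriv i (fsym_deriv j f) = fsym_deriv j (fsym_deriv i f).
Proof. by apply/fsymP => d /=; rewrite mderiv_comm. Qed.

Lemma fsym_deriv_of (i : 'I_n) p : fsym_deriv i (fsym_of p) = fsym_of p^`M(i) :> S.
Proof.
elim/mpolyind: p => [|c m p _ _ IH].
  by rewrite mderiv0 !rmorph0 (der0 (fsym_deriv_derivation i)).
rewrite mderivD !rmorphD (derD_add (fsym_deriv_derivation i)) IH; congr (_ + _).
apply/fsymP => d /=; rewrite mderivZ mderivX !linearZ /= !pihomogX /=.
case: (posnP (m i)) => mi; first by case: ifP; rewrite ?mderiv0 ?mderivX !mi !scale0r !scaler0.
have {1}-> : m = (m - U_(i) + U_(i))%MM by rewrite submK // lep1mP -lt0n.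
rewrite mdegD mdeg1 addn1 eqSS; case: ifP => _; last by rewrite mderiv0 !scaler0.
by rewrite mderivX.
Qed.

Lemma fsym_natr_unit : [pchar F] =i pred0 -> forall j : nat, (j.+1)%:R \is a @GRing.unit S.
Proof.
move=> F0 j; apply/unitrP; exists (fsym_of (j.+1%:R^-1)%:MP).
have -> : j.+1%:R = fsym_of (j.+1%:R)%:MP :> S by rewrite !rmorph_nat.
have e : fsym_of (j.+1%:R^-1)%:MP * fsym_of (j.+1%:R)%:MP = 1 :> S.
  by rewrite -rmorphM -mpolyCM mulVf ?((pcharf0P F).1 F0) // mpolyC1 rmorph1.
by rewrite e mulrC e.
Qed.

Lemma mdeg_gt0_ex (e : 'X_{1..n}) d : mdeg e = d.+1 -> exists i, (0 < e i)%N.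
Proof.
move=> md; apply/existsP; apply: contra_eqT md => /existsPn m0.
rewrite mdegE big1 // => i _; apply/eqP; rewrite -leqn0 leqNgt; exact: m0.
Qed.

Lemma mcoeff_of_deriv (i : 'I_n) p (e : 'X_{1..n}) :
  [pchar F] =i pred0 -> (0 < e i)%N -> p^`M(i) = 0 -> p@_e = 0.
Proof.
move=> F0 ei /(congr1 (mcoeff (e - U_(i))%MM)).
rewrite mcoeff0 mcoeff_mderiv submK ?lep1mP -?lt0n // -mulr_natr => /eqP.
by rewrite mulf_eq0 ((pcharf0P F).1 F0) orbF => /eqP.
Qed.

End FormalSymTheory.

Section SubstTheory.
Context {F : fieldType} {n p : nat} (u : n.-tuple {mpoly F[p]}).
Hypothesis uh : forall i, tnth u i \is 1.-homog.

Lemma fsym_subst_zmod_morphism : zmod_morphism (fsym_subst uh).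
Proof. by move=> f g; apply/fsymP => d; rewrite fsymD fsymN /= comp_mpolyB. Qed.

Lemma fsym_subst_of q : fsym_subst uh (fsym_of q) = fsym_of (q \mPo u).
Proof.
elim/mpolyind: q => [|c m q _ _ IH].
  by apply/fsymP => d; rewrite /= !(pihomog0, comp_mpoly0).
apply/fsymP => d; move/fsymP: IH => /(_ d) /= IH.
rewrite /= !(pihomogD, comp_mpolyD) IH !linearZ /=; congr (_ *: _ + _).
have : 'X_[m] \mPo u \is (mdeg m).-homog.
  by have := fsym_subst_homog uh (fsym_of 'X_[m]) (mdeg m); rewrite /= pihomogX eqxx.
rewrite pihomogX /=; case: eqP => [<-|/eqP ne] hX; first by rewrite pihomog_dE.
by rewrite (pihomog_ne0 ne) ?comp_mpoly0.
Qed.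

Lemma fsym_subst_monoid_morphism : monoid_morphism (fsym_subst uh).
Proof.
split=> [|f g]; first by rewrite fsym_subst_of comp_mpoly1.
apply/fsymP => d; rewrite fsymM /= rmorph_sum /=.
by apply: eq_bigr => i _; rewrite rmorphM.
Qed.

HB.instance Definition _ := GRing.isZmodMorphism.Build
  (Defs.fsym F n) (Defs.fsym F p) (fsym_subst uh) fsym_subst_zmod_morphism.
HB.instance Definition _ := GRing.isMonoidMorphism.Build
  (Defs.fsym F n) (Defs.fsym F p) (fsym_subst uh) fsym_subst_monoid_morphism.

Lemma mderiv_comp (i : 'I_p) q :
  (q \mPo u)^`M(i) = \sum_j (tnth u j)^`M(i) * (q^`M(j) \mPo u).
Proof.
pose T q := (q \mPo u)^`M(i) = \sum_j (tnth u j)^`M(i) * (q^`M(j) \mPo u).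
have TC c : T c%:MP.
  rewrite /T comp_mpolyC mderivC big1 // => j _.
  by rewrite mderivC comp_mpoly0 mulr0.
have TM q1 q2 : T q1 -> T q2 -> T (q1 * q2).
  rewrite /T rmorphM mderivM => -> ->; rewrite mulr_suml mulr_sumr -big_split /=.
  by apply: eq_bigr => j _; rewrite mderivM rmorphD !rmorphM /=; ring.
elim/mpolyind: q => [|c m q _ _ IH]; first by rewrite -mpolyC0; exact: (TC).
have TX : T (c *: 'X_[m]).
  rewrite -mul_mpolyC mpolyXE_id; apply: (TM) => //.
  apply: (big_ind T) => [|x y|j _]; [exact: (TC) | exact: (TM) | ].
  elim: (m j) => [|e IHe]; first exact: (TC).
  rewrite exprS; apply: (TM) => //; rewrite /T comp_mpolyXU -tnth_nth.
  rewrite (bigD1 j) //= mderivX mnm1E eqxx scale1r -{1}[U_(j)%MM]add0m addmK mpolyX0 rmorph1 mulr1.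
  rewrite big1 ?addr0 // => h hj; rewrite mderivX mnm1E [j == h]eq_sym (negPf hj) scale0r.
  by rewrite comp_mpoly0 mulr0.
rewrite comp_mpolyD mderivD TX IH -big_split /=; apply: eq_bigr => j _.
by rewrite mderivD comp_mpolyD mulrDr.
Qed.

Lemma fsym_deriv_subst (c : 'I_n -> F) (i : 'I_p) f :
    (forall j, (tnth u j)^`M(i) = (c j)%:MP) ->
  fsym_deriv i (fsym_subst uh f) =
  fsym_subst uh (\sum_j fsym_of (c j)%:MP * fsym_deriv j f).
Proof.
move=> uc; have -> : fsym_subst uh (\sum_j fsym_of (c j)%:MP * fsym_deriv j f) =
    \sum_j fsym_subst uh (fsym_of (c j)%:MP) * fsym_subst uh (fsym_deriv j f).
  by rewrite rmorph_sum; apply: eq_bigr => j _; apply: rmorphM.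
apply/fsymP => d.
rewrite fsym_sumE [LHS]mderiv_comp; apply: eq_bigr => j _.
by rewrite uc fsym_subst_of comp_mpolyC fsym_ofCM.
Qed.

End SubstTheory.

(** * Linear functions and restriction to the dual of k *)

Section LieAlgebraTheory.
Context {F : fieldType} {g : lieAlgType F}.
Implicit Types x y z : g.

Lemma lieDr x y z : lie x (y + z) = lie x y + lie x z.
Proof. by have := lie_linearr x 1 y z; rewrite !scale1r. Qed.

Lemma lieDl x y z : lie (x + y) z = lie x z + lie y z.
Proof. by have := lie_linearl z 1 x y; rewrite !scale1r. Qed.

Lemma lie0r x : lie x 0 = 0.
Proof. by apply: (addrI (lie x 0)); rewrite -lieDr !addr0. Qed.

Lemma lie0l x : lie 0 x = 0.
Proof. by apply: (addrI (lie 0 x)); rewrite -lieDl !addr0. Qed.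

Lemma lieZr x a y : lie x (a *: y) = a *: lie x y.
Proof. by have := lie_linearr x a y 0; rewrite lie0r !addr0. Qed.

Lemma lieZl x a y : lie (a *: x) y = a *: lie x y.
Proof. by have := lie_linearl y a x 0; rewrite lie0l !addr0. Qed.

Lemma lie_sumr x (I : Type) (r : seq I) (P : pred I) (f : I -> g) :
  lie x (\sum_(i <- r | P i) f i) = \sum_(i <- r | P i) lie x (f i).
Proof. exact: (big_morph (lie x) (lieDr x) (lie0r x)). Qed.

Lemma lie_suml x (I : Type) (r : seq I) (P : pred I) (f : I -> g) :
  lie (\sum_(i <- r | P i) f i) x = \sum_(i <- r | P i) lie (f i) x.
Proof. exact: (big_morph (lie ^~ x) (fun y z => lieDl y z x) (lie0l x)). Qed.

Lemma lie_anti x y : lie y x = - lie x y.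
Proof.
apply/eqP; rewrite -addr_eq0; have := liexx (x + y).
by rewrite lieDl !lieDr !liexx add0r addr0 addrC => ->.
Qed.

Lemma lieNr x y : lie x (- y) = - lie x y.
Proof. by rewrite -scaleN1r lieZr scaleN1r. Qed.

Lemma lie_leibniz x y z : lie x (lie y z) = lie (lie x y) z + lie y (lie x z).
Proof.
apply/eqP; rewrite -subr_eq0 opprD addrA addrAC -(lie_jacobi x y z); apply/eqP.
by rewrite (lie_anti x z) lieNr (lie_anti (lie x y) z).
Qed.

End LieAlgebraTheory.

Section LinearFunctions.
Context {F : fieldType} {g : lieAlgType F} (h : {vspace g}).
Local Notation cst c := (fsym_of c%:MP : ffunc h).

Lemma linpD x y : linp h (x + y) = linp h x + linp h y.
Proof. by rewrite -big_split; apply: eq_bigr => i _; rewrite linearD scalerDl. Qed.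

Lemma linpZ a x : linp h (a *: x) = a *: linp h x.
Proof. by rewrite scaler_sumr; apply: eq_bigr => i _; rewrite linearZ scalerA. Qed.

Lemma flinD x y : flin h (x + y) = flin h x + flin h y.
Proof. by rewrite /flin linpD rmorphD. Qed.

Lemma flinZ a x : flin h (a *: x) = cst a * flin h x.
Proof. by rewrite /flin linpZ -mul_mpolyC rmorphM. Qed.

Lemma flin0 : flin h 0 = 0.
Proof. by apply: (addrI (flin h 0)); rewrite -flinD !addr0. Qed.

Lemma flinN x : flin h (- x) = - flin h x.
Proof. by apply: (addrI (flin h x)); rewrite -flinD !subrr flin0. Qed.

Lemma flin_sum (I : Type) (r : seq I) (P : pred I) (f : I -> g) :
  flin h (\sum_(i <- r | P i) f i) = \sum_(i <- r | P i) flin h (f i).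
Proof. exact: (big_morph (flin h) flinD flin0). Qed.

Lemma mderiv_linp i x : (linp h x)^`M(i) = (coord (vbasis h) i x)%:MP.
Proof.
rewrite /linp linear_sum (bigD1 i) //= big1 => [|j ji]; rewrite mderivZ mderivX mnm1E.
  rewrite eqxx scale1r -{1}[U_(i)%MM]add0m addmK mpolyX0 addr0 -mul_mpolyC.
  by rewrite mulr1.
by rewrite (negPf ji) scale0r scaler0.
Qed.

Lemma fsym_deriv_flin i x : fsym_deriv i (flin h x) = cst (coord (vbasis h) i x).
Proof. by rewrite fsym_deriv_of mderiv_linp. Qed.

(* The derivative in the direction of the linear form on h with values c on
   the basis. *)
Definition fdir (c : 'I_(\dim h) -> F) (f : ffunc h) : ffunc h :=
  \sum_i cst (c i) * fsym_deriv i f.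

Lemma lincomb_derivation (A : comNzRingType) (I : finType) (c : I -> A) (E : I -> A -> A) :
  (forall i, derivation (E i)) -> derivation (fun a => \sum_i c i * E i a).
Proof.
move=> derE; split=> a b.
  by rewrite -big_split; apply: eq_bigr => i _; rewrite (derD_add (derE i)) mulrDr.
rewrite mulr_suml mulr_sumr -big_split; apply: eq_bigr => i _.
by rewrite (der_mul (derE i)) /=; ring.
Qed.

Lemma fdir_derivation c : derivation (fdir c).
Proof. by apply: lincomb_derivation => i; apply: fsym_deriv_derivation. Qed.

Lemma fad_derivation x : derivation (fad h x).
Proof. by apply: lincomb_derivation => i; apply: fsym_deriv_derivation. Qed.

Lemma fsym_deriv_cst i a : fsym_deriv i (cst a) = 0.
Proof. by rewrite fsym_deriv_of mderivC rmorph0. Qed.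

Lemma fad_cst x a : fad h x (cst a) = 0.
Proof. by rewrite /fad big1 // => i _; rewrite fsym_deriv_cst mulr0. Qed.

Lemma fdir_comm c c' f : fdir c (fdir c' f) = fdir c' (fdir c f).
Proof.
have E a b : fdir a (fdir b f) =
    \sum_i \sum_j cst (a i) * cst (b j) * fsym_deriv i (fsym_deriv j f).
  rewrite /fdir; apply: eq_bigr => i _.
  rewrite (der_sum (fsym_deriv_derivation i)) mulr_sumr; apply: eq_bigr => j _.
  by rewrite (der_mul (fsym_deriv_derivation i)) fsym_deriv_cst mul0r add0r mulrA.
rewrite !E exchange_big; apply: eq_bigr => i _; apply: eq_bigr => j _.
by rewrite fsym_deriv_comm [cst (c j) * _]mulrC.
Qed.

Lemma fdir_flin (xi : {linear g -> F^o}) x : x \in h ->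
  fdir (fun i => xi (vbasis h)`_i) (flin h x) = cst (xi x : F).
Proof.
move=> xh; rewrite {2}(coord_vbasis xh) !linear_sum !rmorph_sum /=.
apply: eq_bigr => i _; rewrite fsym_deriv_flin linearZ /=.
by rewrite mulrC -rmorphM -mpolyCM.
Qed.

Lemma fad_flin x y : y \in h -> fad h x (flin h y) = flin h (lie x y).
Proof.
move=> yh; rewrite {2}(coord_vbasis yh) lie_sumr flin_sum.
apply: eq_bigr => i _; rewrite fsym_deriv_flin lieZr flinZ mulrC.
by [].
Qed.

End LinearFunctions.

Section Restriction.
Context {F : fieldType} {g : lieAlgType F} (l k m : {vspace g}).

HB.instance Definition _ := GRing.isZmodMorphism.Build (ffunc l) (ffunc k)
  (fres l k m) (fsym_subst_zmod_morphism (@fres_homog _ _ l k m)).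
HB.instance Definition _ := GRing.isMonoidMorphism.Build (ffunc l) (ffunc k)
  (fres l k m) (fsym_subst_monoid_morphism (@fres_homog _ _ l k m)).

Hypotheses (klm : (k + m = l)%VS) (km0 : (k :&: m = 0)%VS).

Local Notation pk := (daddv_pi k m).
Local Notation pm := (daddv_pi m k).
(** [Dk c] and [Dm b] differentiate along the basis of the dual of [l] that is dual to the bases of
    [k] and [m] put together: the former are tangent to the dual of [k], the latter transverse to
    it. *)
Local Notation Dk c := (fdir (fun a => coord (vbasis k) c (pk (vbasis l)`_a))).
Local Notation Dm b := (fdir (fun a => coord (vbasis m) b (pm (vbasis l)`_a))).

Lemma fres_cst a : fres l k m (fsym_of a%:MP) = fsym_of a%:MP.
Proof. by rewrite /fres fsym_subst_of comp_mpolyC. Qed.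

Lemma fres_flin x : x \in l -> fres l k m (flin l x) = flin k (pk x).
Proof.
move=> xl; rewrite {2}(coord_vbasis xl) linear_sum flin_sum /fres fsym_subst_of.
rewrite [linp l x]/linp linear_sum rmorph_sum; apply: eq_bigr => i _.
rewrite /= comp_mpolyZ comp_mpolyXU -[X in _ *: X]tnth_nth tnth_mktuple [pk (_ *: _)]linearZ.
by rewrite flinZ -mul_mpolyC [LHS]rmorphM.
Qed.

Lemma fsym_deriv_fres c f : fsym_deriv c (fres l k m f) = fres l k m (Dk c f).
Proof.
apply: fsym_deriv_subst => j; rewrite tnth_mktuple mderiv_linp.
by [].
Qed.

Lemma split_vbasis x : x \in l ->
  x = \sum_(c < \dim k) coord (vbasis k) c (pk x) *: (vbasis k)`_c
    + \sum_(b < \dim m) coord (vbasis m) b (pm x) *: (vbasis m)`_b.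
Proof.
move=> xl; rewrite -!coord_vbasis ?memv_pi //.
by rewrite daddv_pi_add // klm.
Qed.

Lemma fsym_deriv_split a (f : ffunc l) : fsym_deriv a f =
  \sum_(c < \dim k) fsym_of (coord (vbasis l) a (vbasis k)`_c)%:MP * Dk c f
  + \sum_(b < \dim m) fsym_of (coord (vbasis l) a (vbasis m)`_b)%:MP * Dm b f.
Proof.
under eq_bigr do rewrite mulr_sumr; under [X in _ + X]eq_bigr do rewrite mulr_sumr.
rewrite exchange_big [X in _ + X]exchange_big -big_split /= (bigD1 a) //=.
have E (j : 'I_(\dim l)) : \sum_(c < \dim k) fsym_of (coord (vbasis l) a (vbasis k)`_c)%:MP *
        (fsym_of (coord (vbasis k) c (pk (vbasis l)`_j))%:MP * fsym_deriv j f) +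
      \sum_(b < \dim m) fsym_of (coord (vbasis l) a (vbasis m)`_b)%:MP *
        (fsym_of (coord (vbasis m) b (pm (vbasis l)`_j))%:MP * fsym_deriv j f) =
    fsym_of (j == a)%:R%:MP * fsym_deriv j f.
  have ejl : (vbasis l)`_j \in l by rewrite vbasis_mem // mem_nth ?size_tuple.
  have <- : coord (vbasis l) a (vbasis l)`_j = (j == a)%:R.
    by rewrite coord_free ?(basis_free (vbasisP l)) // eq_sym.
  rewrite {3}(split_vbasis ejl) linearD !linear_sum mpolyCD rmorphD mulrDl.
  rewrite !rmorph_sum !mulr_suml; congr (_ + _); apply: eq_bigr => c _.
    by rewrite linearZ mulrA -rmorphM -mpolyCM; congr (fsym_of _%:MP * _); apply: mulrC.
  by rewrite linearZ mulrA -rmorphM -mpolyCM; congr (fsym_of _%:MP * _); apply: mulrC.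
rewrite E eqxx mpolyC1 rmorph1 mul1r big1 ?addr0 // => j /negPf ja.
by rewrite E ja mpolyC0 rmorph0 mul0r.
Qed.

(** The vector field of [ad x] does not depend on the basis used to write it; in the adapted basis
    its tangent and transverse parts separate. *)
Lemma fad_split x f : fad l x f =
  \sum_(c < \dim k) flin l (lie x (vbasis k)`_c) * Dk c f
  + \sum_(b < \dim m) flin l (lie x (vbasis m)`_b) * Dm b f.
Proof.
under eq_bigr do rewrite mulr_sumr; under [X in _ + X]eq_bigr do rewrite mulr_sumr.
rewrite exchange_big [X in _ + X]exchange_big -big_split /=; apply: eq_bigr => j _.
have ejl : (vbasis l)`_j \in l by rewrite vbasis_mem // mem_nth ?size_tuple.
rewrite {1}(split_vbasis ejl) lieDr !lie_sumr flinD !flin_sum mulrDl !mulr_suml.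
by congr (_ + _); apply: eq_bigr => c _; rewrite lieZr flinZ; ring.
Qed.

End Restriction.

(** * Order of vanishing along the dual of k *)

Section VanishingOrder.
Context {F : fieldType} {g : lieAlgType F} (l k m : {vspace g}).
Hypotheses (F0 : [pchar F] =i pred0).
Hypotheses (klm : (k + m = l)%VS) (km0 : (k :&: m = 0)%VS).
Hypothesis kmm : lie_stable k m m.

Local Notation pk := (daddv_pi k m).
Local Notation pm := (daddv_pi m k).
Local Notation Dk c := (fdir (fun a => coord (vbasis k) c (pk (vbasis l)`_a))).
Local Notation Dm b := (fdir (fun a => coord (vbasis m) b (pm (vbasis l)`_a))).
Local Notation phi := (fres l k m).

(* Membership in the n-th power of the ideal of functions vanishing on k^*. *)
Fixpoint vanish n (f : ffunc l) : Prop :=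
  if n is n'.+1 then phi f = 0 /\ (forall b : 'I_(\dim m), vanish n' (Dm b f)) else True.

Lemma vanishD n f f' : vanish n f -> vanish n f' -> vanish n (f + f').
Proof.
elim: n f f' => //= n IH f f' [f0 df] [f'0 df']; split=> [|b].
  by rewrite rmorphD /= f0 f'0 addr0.
by rewrite (derD_add (fdir_derivation _)); apply: IH.
Qed.

Lemma vanishW n f : vanish n.+1 f -> vanish n f.
Proof.
elim: n f => // n IH f [f0 df]; split=> // b; apply: IH; exact: df.
Qed.

Lemma vanishM n f h : vanish n f -> vanish n (h * f).
Proof.
elim: n f h => //= n IH f h [f0 df]; split=> [|b]; first by rewrite rmorphM /= f0 mulr0.
rewrite (der_mul (fdir_derivation _)); apply: vanishD; apply: IH => //.
exact: (@vanishW n f).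
Qed.

Lemma vanish0 n : vanish n 0.
Proof.
by elim: n => //= n IH; split=> [|b]; rewrite ?rmorph0 // (der0 (fdir_derivation _)).
Qed.

Lemma vanish_sum n (I : Type) (r : seq I) (P : pred I) (f : I -> ffunc l) :
  (forall i, P i -> vanish n (f i)) -> vanish n (\sum_(i <- r | P i) f i).
Proof.
by move=> fP; elim/big_ind: _ => //; [exact: vanish0 | exact: vanishD].
Qed.

(** By Leibniz: a derivative falling on [h] leaves the order of [f] intact, and one falling on [f]
    is covered by induction. *)
Lemma vanish_mul1 n f h : vanish 1 h -> vanish n f -> vanish n.+1 (h * f).
Proof.
move=> h1; elim: n f => [|n IH] f fn; split; try by rewrite rmorphM /= h1.1 mul0r.
  by [].
move=> b; rewrite (der_mul (fdir_derivation _)); apply: vanishD; first exact: vanishM.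
exact: IH (fn.2 b).
Qed.

(** [Dk c] commutes with the transverse derivatives, and after restriction it differentiates a
    function that is already zero. *)
Lemma vanish_Dk n c f : vanish n f -> vanish n (Dk c f).
Proof.
elim: n f => //= n IH f [f0 df]; split=> [|b].
  by rewrite -fsym_deriv_fres f0 (der0 (fsym_deriv_derivation _)).
by rewrite fdir_comm; apply: IH.
Qed.

Lemma vanish_deriv n a f : vanish n.+1 f -> vanish n (fsym_deriv a f).
Proof.
move=> fn; rewrite (fsym_deriv_split klm km0).
apply: vanishD; apply: vanish_sum => c _; apply: vanishM.
  exact/vanish_Dk/vanishW.
exact: fn.2.
Qed.

(** Restriction detects the constant term. In characteristic 0 a component of positive degree is
    determined by its partial derivatives, which again vanish to every order. *)
Lemma vanish_eq0 f : (forall n, vanish n f) -> f = 0.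
Proof.
move=> fn; apply/fsymP => d; elim: d f fn => [|d IH] f fn.
  have /fsymP /(_ 0%N) := (fn 1%N).1; rewrite !fsym0E /= (dhomog0E (fcompP f 0)).
  by rewrite comp_mpolyC => /eqP; rewrite mpolyC_eq0 => /eqP ->; rewrite mpolyC0.
rewrite fsym0E; apply/mpolyP => mm; rewrite mcoeff0.
have [md|md] := eqVneq (mdeg mm) d.+1; last exact: (dhomog_nemf_coeff (fcompP f d.+1)).
have [i mi] := mdeg_gt0_ex md.
apply: (mcoeff_of_deriv F0 mi).
exact: IH (fsym_deriv i f) (fun n => vanish_deriv i (fn n.+1)).
Qed.

Lemma memk_split x : x \in k -> pk x = x /\ pm x = 0.
Proof.
move=> xk; have e := daddv_pi_id km0 xk; split=> //.
have : x \in (k + m)%VS by apply: subvP xk; apply: addvSl.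
by move/(daddv_pi_add km0); rewrite e -[RHS]addr0 => /addrI.
Qed.

Lemma memm_split x : x \in m -> pk x = 0 /\ pm x = x.
Proof.
move=> xm; have mk0 : (m :&: k = 0)%VS by rewrite capvC.
have e := daddv_pi_id mk0 xm; split=> //.
have : x \in (m + k)%VS by apply: subvP xm; apply: addvSl.
by move/(daddv_pi_add mk0); rewrite e -[RHS]addr0 => /addrI.
Qed.

Lemma memk_l x : x \in k -> x \in l.
Proof. by move=> xk; rewrite -klm; apply: subvP xk; apply: addvSl. Qed.

Lemma memm_l x : x \in m -> x \in l.
Proof. by move=> xm; rewrite -klm; apply: subvP xm; apply: addvSr. Qed.

Lemma lie_stable_mk x y : x \in m -> y \in k -> lie x y \in m.
Proof. by move=> xm yk; rewrite lie_anti rpredN kmm. Qed.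

Local Notation em b := ((vbasis m)`_b).
Local Notation ek c := ((vbasis k)`_c).

Lemma vbasis_tuple_mem (h : {vspace g}) (i : 'I_(\dim h)) : (vbasis h)`_i \in h.
Proof. by rewrite vbasis_mem // mem_nth // size_tuple. Qed.

Lemma vanish_flin x : x \in m -> vanish 1 (flin l x).
Proof.
move=> xm; split=> //=; rewrite fres_flin ?memm_l //.
by rewrite (memm_split xm).1 flin0.
Qed.

Lemma Dm_flin b x : x \in k -> Dm b (flin l x) = 0.
Proof.
move=> xk; have := fdir_flin (coord (vbasis m) b \o pm : {linear g -> F^o}) (memk_l xk).
by rewrite /= (memk_split xk).2 linear0 rmorph0.
Qed.

(** The parameter [h] is [k] for omega itself and [l] for its lift to the dual of [l]. *)
Definition omega_on (h : {vspace g}) : 'M[ffunc h]_(\dim m) :=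
  \matrix_(a, b) flin h (pk (lie (em a) (em b))).

Hypothesis domega : \det (omega_on k) != 0.

Hypothesis lsub : lie_subalgebra l.

(** The lifted determinant involves only linear functions from [k], so its transverse derivatives
    are zero, and its restriction is nonzero in a domain. It can therefore be cancelled at each
    order. *)
Lemma vanish_det_omega n h : vanish n (\det (omega_on l) * h) -> vanish n h.
Proof.
have D0 b : Dm b (\det (omega_on l)) = 0.
  rewrite der_det; last exact: fdir_derivation.
  rewrite big1 // => i _; rewrite big1 // => j _.
  by rewrite mxE Dm_flin ?mul0r // memv_pi.
have phid : phi (\det (omega_on l)) = \det (omega_on k).
  rewrite -det_map_mx; congr (\det _); apply/matrixP => i j; rewrite !mxE /=.
  rewrite fres_flin ?memk_l ?memv_pi //.
  by rewrite (memk_split (memv_pi _ _ _)).1.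
elim: n h => //= n IH h [p0 dh]; split=> [|b].
  by move/eqP: p0; rewrite rmorphM /= phid mulf_eq0 (negPf domega) => /eqP.
apply: IH; have := dh b; rewrite (der_mul (fdir_derivation _)) D0 mul0r add0r.
by [].
Qed.

Lemma vanish_step n f : vanish n f -> (forall x, x \in m -> vanish n (fad l x f)) ->
  forall b, vanish n (Dm b f).
Proof.
move=> fn fadn b; apply: vanish_det_omega.
have row a : vanish n (\sum_(c < \dim m) omega_on l a c * Dm c f).
  (* [T] collects the part of [ad (e_a) f] known to have order [n]: tangent derivatives keep the
     order of [f], and in the second sum the coefficient vanishes on the dual of [k], which makes up
     for the order lost by [Dm c f]. *)
  pose T := \sum_(c < \dim k) flin l (lie (em a) (ek c)) * Dk c f
    + \sum_(c < \dim m) flin l (pm (lie (em a) (em c))) * Dm c f.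
  have -> : \sum_(c < \dim m) omega_on l a c * Dm c f = fad l (em a) f - T.
    rewrite (fad_split klm km0) /T opprD addrACA subrr add0r -sumrB.
    apply: eq_bigr => c _; rewrite mxE -mulrBl; congr (_ * _); apply/eqP.
    rewrite eq_sym subr_eq -flinD daddv_pi_add // klm.
    by apply: lsub; apply: memm_l; apply: vbasis_tuple_mem.
  apply: vanishD; first exact/fadn/vbasis_tuple_mem.
  rewrite -mulN1r; apply: vanishM; apply: vanishD; apply: vanish_sum => c _.
    exact/vanishM/vanish_Dk.
  case: (n) fn => // n' fn; apply: vanish_mul1; last exact: fn.2.
  exact/vanish_flin/memv_pi.
(* Cramer's rule: the adjugate solves the system up to the determinant, which [vanish_det_omega] has
   already removed from the goal's conclusion. *)
have -> : \det (omega_on l) * Dm b f =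
    \sum_a (\adj (omega_on l)) b a * (\sum_(c < \dim m) omega_on l a c * Dm c f).
  under eq_bigr do rewrite mulr_sumr; rewrite exchange_big /=.
  under eq_bigr do (under eq_bigr do rewrite mulrA); under eq_bigr do rewrite -mulr_suml.
  have E c : \sum_a (\adj (omega_on l)) b a * omega_on l a c = (\det (omega_on l))%:M b c.
    by rewrite -mul_adj_mx mxE.
  rewrite (bigD1 b) //= E mxE eqxx big1 ?addr0 // => c /negPf cb.
  by rewrite E mxE eq_sym cb mul0r.
by apply: vanish_sum => a _; apply: vanishM.
Qed.

Lemma stable_vanishing_eq0 (J : ffunc l -> Prop) :
  (forall f, J f -> phi f = 0) ->
  (forall x f, x \in m -> J f -> J (fad l x f)) ->
  forall f, J f -> f = 0.
Proof.
(* The induction is over all of [J] at once, because order [n.+1] for [f] needs order [n] for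
   [fad l x f]. *)
move=> J0 Jad f Jf; apply: vanish_eq0 => n; elim: n f Jf => // n IH f Jf.
split; first exact: J0.
by apply: vanish_step => [|x xm]; apply: IH => //; apply: Jad.
Qed.

Lemma fres_zero_locus (Delta : ffunc l) :
  Delta != 0 -> zero_locus_invariant l Delta -> phi Delta != 0.
Proof.
move=> Delta0 inv; apply: contraNneq Delta0 => D0; apply/eqP.
apply: (@stable_vanishing_eq0 (vanishing_on_zeros Delta)) => [f [n [u e]]|x f xm|].
- have := congr1 phi e; rewrite rmorphM /= D0 mulr0 rmorphXn => /eqP.
  by rewrite expf_eq0 => /andP [_ /eqP].
- by apply: inv; apply: memm_l.
- exact: radical_gen.
Qed.

Hypothesis ksub : lie_subalgebra k.

(** For [x] in [k] the vector field is tangent to the dual of [k]: its transverse coefficients come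
    from [m] and restrict to zero. *)
Lemma fres_fad x f : x \in k -> phi (fad l x f) = fad k x (phi f).
Proof.
move=> xk; rewrite (fad_split klm km0) rmorphD !rmorph_sum /=.
rewrite [X in _ + X]big1 ?addr0 => [|b _].
  apply: eq_bigr => c _; rewrite rmorphM /= -fsym_deriv_fres; congr (_ * _).
  have xc : lie x (ek c) \in k by apply: ksub => //; apply: vbasis_tuple_mem.
  by rewrite fres_flin ?memk_l // (memk_split xc).1.
have xb : lie x (em b) \in m by apply: kmm => //; apply: vbasis_tuple_mem.
by rewrite rmorphM /= fres_flin ?memm_l // (memm_split xb).1 flin0 mul0r.
Qed.

(** A function in the radical of [phi Delta] lifts to the radical of [Delta] only modulo the kernel
    of [phi], so stability is not inherited directly. The iterated derivatives of [phi Delta] do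
    lift, and [radical_stable] needs nothing more. *)
Lemma zero_locus_fres (Delta : ffunc l) :
  zero_locus_invariant l Delta -> zero_locus_invariant k (phi Delta).
Proof.
move=> inv x xk; apply: radical_stable; first exact: fad_derivation.
  exact: fsym_natr_unit.
move=> i; have -> : iter i (fad k x) (phi Delta) = phi (iter i (fad l x) Delta).
  by elim: i => //= i ->; rewrite fres_fad.
have : vanishing_on_zeros Delta (iter i (fad l x) Delta).
  by elim: i => [|i]; [exact: radical_gen | apply: inv; apply: memk_l].
by move=> [n [u e]]; exists n, (phi u); rewrite -rmorphXn e rmorphM.
Qed.

(** Equivariance of omega under [k]: the Jacobi identity, and the fact that the projection to [k]
    commutes with [ad x]. The matrix is that of [ad x] on [m]. *)
Lemma fad_omega x : x \in k ->
  map_mx (fad k x) (omega_on k) =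
  (\matrix_(b, a) fsym_of (coord (vbasis m) b (lie x (em a)))%:MP)^T *m omega_on k
  + omega_on k *m (\matrix_(b, a) fsym_of (coord (vbasis m) b (lie x (em a)))%:MP).
Proof.
move=> xk; apply/matrixP => a b; rewrite !mxE fad_flin ?memv_pi //.
have mE (c : 'I_(\dim m)) : lie x (em c) = \sum_(d < \dim m) coord (vbasis m) d (lie x (em c)) *: em d.
  by apply: coord_vbasis; apply: kmm => //; apply: vbasis_tuple_mem.
have -> : lie x (pk (lie (em a) (em b))) = pk (lie (lie x (em a)) (em b)) + pk (lie (em a) (lie x (em b))).
  have ab : lie (em a) (em b) \in (k + m)%VS.
    by rewrite klm; apply: lsub; apply: memm_l; apply: vbasis_tuple_mem.
  have -> : lie x (pk (lie (em a) (em b))) = pk (lie x (lie (em a) (em b))).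
    rewrite -{2}(daddv_pi_add km0 ab) lieDr linearD /=.
    rewrite (memk_split (ksub xk (memv_pi _ _ _))).1.
    by rewrite (memm_split (kmm xk (memv_pi _ _ _))).1 addr0.
  by rewrite lie_leibniz linearD.
rewrite flinD; congr (_ + _).
  rewrite {1}mE lie_suml linear_sum flin_sum; apply: eq_bigr => d _.
  by rewrite lieZl linearZ flinZ !mxE.
rewrite {1}mE lie_sumr linear_sum flin_sum; apply: eq_bigr => d _.
by rewrite lieZr linearZ flinZ !mxE mulrC.
Qed.

(** By [der_det_congr] the determinant is a semi-invariant, so all its iterated derivatives are
    multiples of it. *)
Lemma zero_locus_det_omega : zero_locus_invariant k (\det (omega_on k)).
Proof.
move=> x xk; apply: radical_stable; first exact: fad_derivation.
  exact: fsym_natr_unit.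
have [u e] : exists u, fad k x (\det (omega_on k)) = u * \det (omega_on k).
  rewrite (der_det_congr (fad_derivation _ _) (fad_omega xk)).
  by eexists; reflexivity.
move=> i; suff [v ->] : exists v, iter i (fad k x) (\det (omega_on k)) = v * \det (omega_on k).
  by apply: radicalM; apply: radical_gen.
elim: i => [|i [v IH]]; first by exists 1; rewrite mul1r.
exists (fad k x v + v * u); rewrite /= IH (der_mul (fad_derivation _ _)) e; ring.
Qed.

End VanishingOrder.

(** * Nondegeneracy of the tautological omega *)

Section NonvanishingPoint.
Context {F : fieldType} {n : nat}.
Implicit Types p q : {mpoly F[n]}.

Lemma mpoly_morph_ext (A : comNzRingType) (f f' : {rmorphism {mpoly F[n]} -> A}) :
  (forall c, f c%:MP = f' c%:MP) -> (forall i, f 'X_i = f' 'X_i) -> f =1 f'.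
Proof.
move=> fC fX p; elim/mpolyind: p => [|c e p _ _ IH]; first by rewrite !rmorph0.
rewrite !rmorphD IH; congr (_ + _); rewrite -mul_mpolyC !rmorphM fC.
congr (_ * _); rewrite mpolyXE_id !rmorph_prod; apply: eq_bigr => i _.
by rewrite !rmorphXn fX.
Qed.

Hypothesis F0 : [pchar F] =i pred0.

(** The images of the first [size q] natural numbers are distinct in characteristic 0, too many to
    be all roots. The point comes from [F] although the coefficients do not; below they are
    polynomials in the other variables. *)
Lemma poly_nonroot (A : idomainType) (phi : {rmorphism F -> A}) (q : {poly A}) :
  q != 0 -> exists t, q.[phi t] != 0.
Proof.
move=> q0; apply: contrapT => /forallNP all0; case/eqP: q0.
pose rs := [seq phi j%:R | j <- iota 0 (size q)].
apply: (@roots_geq_poly_eq0 _ q rs); last by rewrite size_map size_iota.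
  by apply/allP => x /mapP [j _ ->]; apply/negPn/negP; apply: all0.
rewrite map_inj_uniq ?iota_uniq // => i j /fmorph_inj.
wlog ij : i j / (i <= j)%N => [hw|].
  by case: (leqP i j) => [|/ltnW] ij e; [apply: hw | apply/esym/hw].
move/eqP; rewrite eq_sym -subr_eq0 -natrB // ((pcharf0P F).1 F0) subn_eq0 => ji.
by apply/eqP; rewrite eqn_leq ij.
Qed.

Lemma mpoly_nonroot p : p != 0 -> exists v, p.@[v] != 0.
Proof.
move=> p0.
pose T (s : seq 'I_n) (v : 'I_n -> F) : n.-tuple {mpoly F[n]} :=
  [tuple if j \in s then (v j)%:MP else 'X_j | j < n].
have TX s v i : 'X_i \mPo T s v = if i \in s then (v i)%:MP else 'X_i.
  by rewrite comp_mpolyXU -tnth_nth tnth_mktuple.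
suff [v] : exists v, p \mPo T (enum 'I_n) v != 0.
  have -> : p \mPo T (enum 'I_n) v = (p.@[v])%:MP.
    apply: (@mpoly_morph_ext _ (comp_mpoly (T (enum 'I_n) v)) (@mpolyC n F \o meval v)) => [c|i] /=.
      by rewrite comp_mpolyC mevalC.
    by rewrite TX mem_enum mevalXU.
  by rewrite mpolyC_eq0; exists v.
elim: (enum 'I_n) => [|i s [v pv]].
  exists (fun=> 0); have -> // : p \mPo T [::] (fun=> 0) = p.
  apply: (@mpoly_morph_ext _ (comp_mpoly (T [::] (fun=> 0))) idfun) => [c|i] /=.
    exact: comp_mpolyC.
  by rewrite TX in_nil.
set q := p \mPo T s v in pv.
(* [h] isolates the variable of index [i], the other variables becoming coefficients; evaluating at
   that variable undoes it, so [h q] is nonzero. *)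
have [h [hC hX]] : exists h : {rmorphism {mpoly F[n]} -> {poly {mpoly F[n]}}},
    (forall c, h c%:MP = (c%:MP)%:P) /\
    (forall j, h 'X_j = if j == i then 'X else ('X_j)%:P).
  exists (mmap (polyC \o @mpolyC n F) (fun j => if j == i then 'X else ('X_j)%:P)).
  by split=> [c|j] /=; rewrite ?mmapC // mmapX mmap1U.
have hq : h q != 0.
  apply: contraNneq pv => hq0; have <- : (h q).['X_i] = q; last by rewrite hq0 horner0.
  apply: (@mpoly_morph_ext _ (horner_eval 'X_i \o h) idfun) => [c|j] /=.
    by rewrite /horner_eval hC hornerC.
  by rewrite /horner_eval hX; case: eqP => [->|_]; rewrite ?hornerX ?hornerC.
have [t qt] := @poly_nonroot _ (@mpolyC n F) _ hq.
pose w j := if j \in s then v j else t.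
exists w; have -> // : p \mPo T (i :: s) w = (h q).[t%:MP].
apply: (@mpoly_morph_ext _ (comp_mpoly (T (i :: s) w))
  (horner_eval t%:MP \o (h \o comp_mpoly (T s v)))) => [c|j] /=.
  by rewrite !comp_mpolyC /horner_eval hC hornerC.
rewrite /horner_eval !TX in_cons /w; case: (j \in s); first by rewrite orbT hC hornerC.
by rewrite orbF hX; case: eqP => _; rewrite ?hornerX ?hornerC.
Qed.

End NonvanishingPoint.

Section Nondegenerate.
Context {F : fieldType} {g : lieAlgType F} (l k m : {vspace g}).
Hypothesis F0 : [pchar F] =i pred0.

(** The polynomial [P] has a nonroot [v]. Were the determinant zero, omega at the form [lam] with
    coordinates [v] would have a nonzero kernel vector in [m], against genericity. *)
Lemma det_omega_neq0 : nondegenerate_splitting l k m -> \det (omega_on k m k) != 0.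
Proof.
case=> klm km0 ksub kmm [P /(mpoly_nonroot F0) [v Pv] Pnd].
have vk (i : 'I_(\dim k)) : (vbasis k)`_i \in k by rewrite vbasis_mem // mem_nth // size_tuple.
pose lam0 (w : subvs_of k) : F^o := \sum_i coord (vbasis k) i (vsval w) * v i.
have lamlin : linear lam0.
  move=> a x y; rewrite /lam0 scaler_sumr -big_split; apply: eq_bigr => i _.
  by rewrite !linearP /= mulrDl -mulrA.
pose lamL := HB.pack_for {linear subvs_of k -> F^o} lam0
  (GRing.isLinear.Build F (subvs_of k) F^o _ lam0 lamlin).
pose lam : 'Hom(subvs_of k, F^o) := linfun lamL.
have lamE x : x \in k -> lam (vsproj k x) = (linp k x).@[v].
  move=> xk; rewrite lfunE /= /lam0 vsprojK // /linp rmorph_sum.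
  by apply: eq_bigr => i _; rewrite /= mevalZ mevalXU.
pose W : 'M[{mpoly F[\dim k]}]_(\dim m) := \matrix_(a, b)
  linp k (daddv_pi k m (lie (vbasis m)`_a (vbasis m)`_b)).
have -> : omega_on k m k = map_mx fsym_of W by apply/matrixP => a b; rewrite !mxE.
rewrite det_map_mx; apply: contraTneq isT => dW0.
have {}dW0 : \det W = 0 by apply: fsym_of_inj; rewrite rmorph0.
pose Wv : 'M[F]_(\dim m) := map_mx (meval v) W.
have /det0P [u u0 uW] : \det Wv == 0 by rewrite det_map_mx dW0 rmorph0.
pose x := \sum_(a < \dim m) u 0 a *: (vbasis m)`_a.
have xm : x \in m by apply: rpred_sum => a _; rewrite rpredZ // vbasis_mem // mem_nth // size_tuple.
case/negP: u0; apply/eqP/rowP => a; rewrite mxE.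
have <- : coord (vbasis m) a x = u 0 a by rewrite coord_sum_free // (basis_free (vbasisP m)).
suff -> : x = 0 by rewrite linear0.
apply: (Pnd lam) => [|//|y ym].
  rewrite (meval_eq _ (v2 := v)) // => i; rewrite lamE // /linp rmorph_sum (bigD1 i) //=.
  rewrite mevalZ mevalXU coord_free ?(basis_free (vbasisP k)) // eqxx mul1r big1 ?addr0 // => j ji.
  by rewrite mevalZ coord_free ?(basis_free (vbasisP k)) // eq_sym (negPf ji) mul0r.
rewrite /omega lamE ?memv_pi //.
pose ev z := (linp k (daddv_pi k m z)).@[v].
have evD z z' : ev (z + z') = ev z + ev z' by rewrite /ev linearD linpD mevalD.
have evZ c z : ev (c *: z) = c * ev z by rewrite /ev linearZ linpZ mevalZ.
have ev0 : ev 0 = 0 by apply: (addrI (ev 0)); rewrite -evD !addr0.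
have ev_sum (f : 'I_(\dim m) -> g) : ev (\sum_a f a) = \sum_a ev (f a).
  exact: (big_morph ev evD ev0).
rewrite -/(ev _) (coord_vbasis ym) lie_sumr ev_sum big1 // => b _.
rewrite lieZr evZ lie_suml ev_sum.
have /rowP /(_ b) := uW; rewrite !mxE => uWb.
rewrite [X in _ * X](_ : _ = 0) ?mulr0 // -[RHS]uWb.
by apply: eq_bigr => c _; rewrite lieZl evZ !mxE.
Qed.

End Nondegenerate.

(** * Tensors in coordinates *)

Section Coordinates.
Context {F : fieldType} {g : lieAlgType F} (h : {vspace g}).
Local Notation N := (\dim {:g}).
Local Notation E i := (vbasis {:g})`_i.
Local Notation K := {fraction (ffunc h)}.
Local Notation co := (coord (vbasis {:g})).

Lemma fconst_zmod_morphism : zmod_morphism (fconst h).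
Proof. by move=> a b; rewrite /fconst !rmorphB. Qed.

Lemma fconst_monoid_morphism : monoid_morphism (fconst h).
Proof. by split=> [|a b]; rewrite /fconst ?rmorph1 // !rmorphM. Qed.

HB.instance Definition _ :=
  GRing.isZmodMorphism.Build F K (fconst h) fconst_zmod_morphism.
HB.instance Definition _ :=
  GRing.isMonoidMorphism.Build F K (fconst h) fconst_monoid_morphism.

Definition vec (x : g) : 'rV[K]_N := \row_p fconst h (co p x).

(** The bracket of g extended bilinearly to the fraction field. *)
Definition br (u v : 'rV[K]_N) : 'rV[K]_N :=
  \row_p \sum_i \sum_j u 0 i * v 0 j * vec (lie (E i) (E j)) 0 p.

(** Row convention: [ad x] acts by multiplication on the right. *)
Definition ad_mx (x : g) : 'M[K]_N := \matrix_(i, p) vec (lie x (E i)) 0 p.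

Lemma coord_fullE (x : g) : x = \sum_i co i x *: E i.
Proof. by apply: coord_vbasis; rewrite memvf. Qed.

Lemma vecD x y : vec (x + y) = vec x + vec y.
Proof. by apply/rowP => p; rewrite !mxE linearD rmorphD. Qed.

Lemma vecZ a x : vec (a *: x) = fconst h a *: vec x.
Proof. by apply/rowP => p; rewrite !mxE linearZ rmorphM. Qed.

Lemma vec0 : vec 0 = 0.
Proof. by apply/rowP => p; rewrite !mxE linear0 rmorph0. Qed.

Lemma vec_sum (I : Type) (r : seq I) (P : pred I) (f : I -> g) :
  vec (\sum_(i <- r | P i) f i) = \sum_(i <- r | P i) vec (f i).
Proof. exact: (big_morph vec vecD vec0). Qed.

Lemma vec_coord (U : {vspace g}) x : x \in U ->
  vec x = \sum_i fconst h (coord (vbasis U) i x) *: vec (vbasis U)`_i.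
Proof.
move=> xU; rewrite {1}(coord_vbasis xU) vec_sum.
by apply: eq_bigr => i _; rewrite vecZ.
Qed.

Lemma vec_coordE (U : {vspace g}) x p : x \in U ->
  vec x 0 p = \sum_i fconst h (coord (vbasis U) i x) * vec (vbasis U)`_i 0 p.
Proof.
by move=> xU; rewrite (vec_coord xU) summxE; apply: eq_bigr => i _; rewrite [LHS]mxE.
Qed.

Lemma brDl u v w : br (u + v) w = br u w + br v w.
Proof.
apply/rowP => p; rewrite !mxE -big_split; apply: eq_bigr => i _.
by rewrite -big_split; apply: eq_bigr => j _; rewrite !mxE !mulrDl.
Qed.

Lemma brDr u v w : br w (u + v) = br w u + br w v.
Proof.
apply/rowP => p; rewrite !mxE -big_split; apply: eq_bigr => i _.
by rewrite -big_split; apply: eq_bigr => j _; rewrite !mxE mulrDr mulrDl.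
Qed.

Lemma brZl a u v : br (a *: u) v = a *: br u v.
Proof.
apply/rowP => p; rewrite !mxE mulr_sumr; apply: eq_bigr => i _.
by rewrite mulr_sumr; apply: eq_bigr => j _; rewrite !mxE !mulrA.
Qed.

Lemma brZr a u v : br u (a *: v) = a *: br u v.
Proof.
apply/rowP => p; rewrite !mxE mulr_sumr; apply: eq_bigr => i _.
by rewrite mulr_sumr; apply: eq_bigr => j _; rewrite !mxE; ring.
Qed.

Lemma br0l v : br 0 v = 0.
Proof. by apply: (addrI (br 0 v)); rewrite -brDl !addr0. Qed.

Lemma br0r v : br v 0 = 0.
Proof. by apply: (addrI (br v 0)); rewrite -brDr !addr0. Qed.

Lemma br_suml v (I : Type) (r : seq I) (P : pred I) (f : I -> 'rV[K]_N) :
  br (\sum_(i <- r | P i) f i) v = \sum_(i <- r | P i) br (f i) v.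
Proof. by elim/big_rec2: _ => [|i a b _ <-]; rewrite ?br0l ?brDl. Qed.

Lemma br_sumr v (I : Type) (r : seq I) (P : pred I) (f : I -> 'rV[K]_N) :
  br v (\sum_(i <- r | P i) f i) = \sum_(i <- r | P i) br v (f i).
Proof. by elim/big_rec2: _ => [|i a b _ <-]; rewrite ?br0r ?brDr. Qed.

Lemma br_anti u v : br v u = - br u v.
Proof.
apply/rowP => p; rewrite !mxE exchange_big -sumrN; apply: eq_bigr => i _.
rewrite -sumrN; apply: eq_bigr => j _; rewrite !mxE lie_anti linearN rmorphN.
by rewrite mulrN [v 0 _ * _]mulrC.
Qed.

Lemma br_vec x y : br (vec x) (vec y) = vec (lie x y).
Proof.
rewrite {2}(coord_fullE x) lie_suml vec_sum; apply/rowP => p; rewrite mxE summxE.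
apply: eq_bigr => i _; rewrite lieZl vecZ {2}(coord_fullE y) lie_sumr vec_sum.
rewrite [RHS]mxE summxE mulr_sumr; apply: eq_bigr => j _.
by rewrite lieZr vecZ !mxE mulrA.
Qed.

Lemma mul_ad_mx x u : u *m ad_mx x = br (vec x) u.
Proof.
have -> : u = \sum_i u 0 i *: vec (E i).
  apply/rowP => p; rewrite summxE (bigD1 p) //= big1 => [|i ip]; rewrite !mxE.
    by rewrite coord_free ?(basis_free (vbasisP _)) // eqxx rmorph1 mulr1 addr0.
  by rewrite coord_free ?(basis_free (vbasisP _)) // (negPf ip) rmorph0 mulr0.
rewrite mulmx_suml br_sumr; apply: eq_bigr => i _; rewrite -scalemxAl brZr br_vec.
congr (_ *: _); apply/rowP => p; rewrite mxE (bigD1 i) //= big1 => [|j ji]; rewrite !mxE.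
  by rewrite coord_free ?(basis_free (vbasisP _)) // eqxx rmorph1 mul1r addr0.
by rewrite coord_free ?(basis_free (vbasisP _)) // eq_sym (negPf ji) rmorph0 mul0r.
Qed.

Lemma sum_delta (f : 'I_N -> K) q : \sum_j f j * fconst h (co q (E j)) = f q.
Proof.
have fE (j : 'I_N) : fconst h (co q (E j)) = (j == q)%:R.
  by rewrite coord_free ?(basis_free (vbasisP _)) // rmorph_nat.
rewrite (bigD1 q) //= fE eqxx mulr1 big1 ?addr0 // => j jq.
by rewrite fE (negPf jq) mulr0.
Qed.

(** The three brackets contract columns or rows of [rho]. Turning columns into rows costs two signs
    in the first, one in the second, which reverses its bracket, and none in the third. *)
Lemma CYB_coord (rho : 'M[K]_N) p q s : rho^T = - rho ->
  CYB rho (p, q, s) = br (row q rho) (row s rho) 0 p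
    + br (row s rho) (row p rho) 0 q + br (row p rho) (row q rho) 0 s.
Proof.
move=> anti; have antiE i j : rho i j = - rho j i.
  by have /matrixP /(_ j i) := anti; rewrite !mxE.
have -> : CYB rho (p, q, s) =
    \sum_i \sum_j \sum_r \sum_t (rho i j * rho r t) *
      (fconst h (co p (lie (E i) (E r))) * fconst h (co q (E j)) * fconst h (co s (E t)))
  + \sum_i \sum_j \sum_r \sum_t (rho i j * rho r t) *
      (fconst h (co p (E i)) * fconst h (co q (lie (E j) (E r))) * fconst h (co s (E t)))
  + \sum_i \sum_j \sum_r \sum_t (rho i j * rho r t) *
      (fconst h (co p (E i)) * fconst h (co q (E r)) * fconst h (co s (lie (E j) (E t)))).
  rewrite /CYB sum_ffunE -!big_split; apply: eq_bigr => i _.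
  rewrite sum_ffunE -!big_split; apply: eq_bigr => j _.
  rewrite sum_ffunE -!big_split; apply: eq_bigr => r _.
  rewrite sum_ffunE -!big_split; apply: eq_bigr => t _ /=.
  rewrite !ffunE /= !rmorphD !rmorphM -!mulrDr; by [].
congr (_ + _ + _).
- rewrite mxE; apply: eq_bigr => i _; rewrite exchange_big; apply: eq_bigr => r _ /=.
  under eq_bigr => j _ do (under eq_bigr => t _ do rewrite mulrA); 
  under eq_bigr => j _ do rewrite sum_delta.
  by under eq_bigr do rewrite mulrA; rewrite sum_delta !mxE (antiE i q) (antiE r s) mulrNN.
- rewrite br_anti !mxE -sumrN exchange_big; apply: eq_bigr => j _.
  rewrite -sumrN exchange_big; apply: eq_bigr => r _ /=.
  transitivity (\sum_i (rho i j * rho r s * vec (lie (E j) (E r)) 0 q) * fconst h (co p (E i))).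
    apply: eq_bigr => i _; under eq_bigr do rewrite mulrA.
    by rewrite sum_delta !mxE; ring.
  by rewrite sum_delta !mxE (antiE r s); ring.
- rewrite mxE exchange_big; apply: eq_bigr => j _.
  under eq_bigr do rewrite exchange_big; rewrite exchange_big; apply: eq_bigr => t _ /=.
  transitivity (\sum_i (rho i j * rho q t * vec (lie (E j) (E t)) 0 s) * fconst h (co p (E i))).
    apply: eq_bigr => i _.
    transitivity (\sum_r (rho i j * rho r t * vec (lie (E j) (E t)) 0 s * fconst h (co p (E i)))
       * fconst h (co q (E r))).
      by apply: eq_bigr => r _; rewrite !mxE; ring.
    by rewrite sum_delta.
  by rewrite sum_delta !mxE.
Qed.

Lemma dtens_coord (rho : 'M[K]_N) p q s :
  dtens rho (p, q, s) =
    \sum_a frac_der (fsym_deriv a) (rho p q) * vec (vbasis h)`_a 0 s.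
Proof.
transitivity (\sum_a \sum_i (\sum_j frac_der (fsym_deriv a) (rho i j) *
    vec (vbasis h)`_a 0 s * fconst h (co q (E j))) * fconst h (co p (E i))).
  rewrite /dtens sum_ffunE exchange_big /=; apply: eq_bigr => i _.
  rewrite sum_ffunE.
  under [RHS]eq_bigr do rewrite mulr_suml; rewrite exchange_big /=; apply: eq_bigr => j _.
  rewrite sum_ffunE; apply: eq_bigr => a _.
  rewrite !ffunE /= !rmorphM /= mxE.
  by rewrite /GRing.scale /=; ring.
by apply: eq_bigr => a _; rewrite sum_delta sum_delta.
Qed.

Lemma invariant_functionP (rho : 'M[K]_N) :
  invariant_function rho <-> forall x, x \in h ->
   map_mx (frac_der (fad h x)) rho + (ad_mx x)^T *m rho + rho *m ad_mx x = 0.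
Proof.
suff H x : \sum_(i < N) \sum_(j < N)
    (frac_der (fad h x) (rho i j) *: ext2 h (tens2 (E i) (E j))
     + rho i j *: ext2 h (tens2 (lie x (E i)) (E j) + tens2 (E i) (lie x (E j)))) =
   map_mx (frac_der (fad h x)) rho + (ad_mx x)^T *m rho + rho *m ad_mx x.
  by split=> inv x xh; [rewrite -H | rewrite H]; apply: inv.
apply/matrixP => p q.
transitivity (\sum_i (\sum_j frac_der (fad h x) (rho i j) * fconst h (co q (E j))) *
      fconst h (co p (E i))
  + \sum_i (\sum_j (rho i j * ad_mx x i p) * fconst h (co q (E j)))
  + \sum_i (\sum_j (rho i j * ad_mx x j q)) * fconst h (co p (E i))).
  rewrite summxE -!big_split; apply: eq_bigr => i _.
  rewrite summxE !mulr_suml -!big_split; apply: eq_bigr => j _.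
  by rewrite !mxE !rmorphD !rmorphM /=; ring.
rewrite !sum_delta !mxE; congr (_ + _ + _).
by apply: eq_bigr => i _; rewrite sum_delta !mxE mulrC.
Qed.

Lemma AltE (xi : tensor3 g K) p q s :
  Alt xi (p, q, s) = xi (p, q, s) + xi (q, s, p) + xi (s, p, q).
Proof. by rewrite ffunE. Qed.

End Coordinates.

(** * The r-matrix of the splitting *)

Section SplittingRMatrix.
Context {F : fieldType} {g : lieAlgType F} (l k m : {vspace g}).
Hypotheses (klm : (k + m = l)%VS) (km0 : (k :&: m = 0)%VS).
Hypotheses (lsub : lie_subalgebra l) (ksub : lie_subalgebra k).
Hypotheses (kmm : lie_stable k m m) (domega : \det (omega_on k m k) != 0).

Local Notation N := (\dim {:g}).
Local Notation K := {fraction (ffunc k)}.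
Local Notation pk := (daddv_pi k m).
Local Notation pm := (daddv_pi m k).
Local Notation em b := ((vbasis m)`_b).
Local Notation ek c := ((vbasis k)`_c).
Local Notation W := (omega_mx k m).
Local Notation P := (invmx W).

Definition mvec : 'M[K]_(\dim m, N) := \matrix_(a, p) vec k (em a) 0 p.
Local Notation M := mvec.
Local Notation Q := (M^T *m P).

Lemma omega_mxE : W = map_mx tofrac (omega_on k m k).
Proof. by apply/matrixP => a b; rewrite !mxE. Qed.

Lemma omega_mx_unit : W \in unitmx.
Proof. by rewrite unitmxE omega_mxE det_map_mx unitfE tofrac_eq0. Qed.

Lemma omega_mx_anti : W^T = - W.
Proof. by apply/matrixP => a b; rewrite !mxE lie_anti linearN flinN rmorphN. Qed.

Lemma inv_omega_anti : P^T = - P.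
Proof.
apply: (can_inj (mulmxK omega_mx_unit)).
rewrite mulNmx (mulVmx omega_mx_unit).
have : P^T *m W^T = 1%:M by rewrite -trmx_mul (mulmxV omega_mx_unit) trmx1.
by rewrite omega_mx_anti mulmxN => <-; rewrite opprK.
Qed.

(** [P^T *m W *m P] is [P^T], that is [- P]; this sign cancels the one in the definition of
    [r_splitting]. *)
Lemma r_splittingE : r_splitting k m = Q *m M.
Proof.
have bivE : biv_inv W = - P.
  by rewrite /biv_inv -mulmxA (mulmxV omega_mx_unit) mulmx1 inv_omega_anti.
rewrite /r_splitting bivE; apply/matrixP => p q; rewrite mxE summxE -sumrN mxE.
under [RHS]eq_bigr do rewrite mxE mulr_suml; rewrite exchange_big.
apply: eq_bigr => a _; rewrite summxE -sumrN; apply: eq_bigr => b _.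
by rewrite !mxE rmorphM /=; ring.
Qed.

Local Notation r := (r_splitting k m).

Lemma tr_mul_inv_omega : Q^T = - (P *m M).
Proof. by rewrite trmx_mul trmxK inv_omega_anti mulNmx. Qed.

Lemma r_splitting_anti : r^T = - r.
Proof. by rewrite r_splittingE trmx_mul tr_mul_inv_omega mulmxN mulmxA. Qed.

(** The reproducing property characterizing the r-matrix of the splitting, on the basis of [m]. It
    is what converts coordinates of elements of [m] into values of omega below. *)
Lemma mul_inv_omegaK : Q *m W = M^T.
Proof. by rewrite (mulmxKV omega_mx_unit). Qed.

Lemma row_r_splitting p : row p r = \sum_b Q p b *: vec k (em b).
Proof.
rewrite r_splittingE; apply/rowP => q; rewrite !mxE summxE.
by apply: eq_bigr => b _; rewrite !mxE.
Qed.

Section Derivative.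
Variable D : ffunc k -> ffunc k.
Hypotheses (derD : derivation D) (D0 : forall c, D (fsym_of c%:MP) = 0).
Local Notation DK := (frac_der D).

Lemma frac_der_fconst c : DK (fconst k c) = 0.
Proof. by rewrite /fconst frac_der_tofrac // D0 tofrac0. Qed.

(** Only [P] varies, since [M] has constant entries; the minus sign of the derivative of an inverse
    is absorbed in [Q^T = - (P *m M)]. *)
Lemma der_r_splitting : map_mx DK r = Q *m map_mx DK W *m Q^T.
Proof.
have derDK := frac_der_derivation derD.
have DM : map_mx DK M = 0 by apply/matrixP => a p; rewrite !mxE frac_der_fconst.
have DMT : map_mx DK M^T = 0 by rewrite -map_trmx DM trmx0.
have DP : map_mx DK P = - (P *m map_mx DK W *m P).
  have : map_mx DK (P *m W) = 0.
    rewrite (mulVmx omega_mx_unit); apply/matrixP => a b; rewrite !mxE.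
    by case: eqP => _; rewrite ?mulr1n ?mulr0n ?(der1 derDK) ?(der0 derDK).
  rewrite (der_mulmx derDK) => /eqP; rewrite addr_eq0 => /eqP e.
  apply: (can_inj (mulmxK omega_mx_unit)).
  by rewrite e mulNmx (mulmxKV omega_mx_unit).
rewrite r_splittingE !(der_mulmx derDK) DM DMT mul0mx add0r mulmx0 addr0 DP tr_mul_inv_omega.
by rewrite !mulmxN mulNmx !mulmxA.
Qed.

End Derivative.

Lemma dtens_r_splitting p q s :
  \sum_c frac_der (fsym_deriv c) (r p q) * vec k (ek c) 0 s =
  \sum_a \sum_b Q p a * Q q b * vec k (pk (lie (em a) (em b))) 0 s.
Proof.
have E c : frac_der (fsym_deriv c) (r p q) = \sum_a \sum_b
    Q p a * Q q b * fconst k (coord (vbasis k) c (pk (lie (em a) (em b)))).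
  have /matrixP /(_ p q) := der_r_splitting (fsym_deriv_derivation c) (fsym_deriv_cst c).
  rewrite mxE => ->; rewrite mxE exchange_big /=; apply: eq_bigr => b _.
  rewrite mxE mulr_suml; apply: eq_bigr => a _; rewrite !mxE.
  by rewrite frac_der_tofrac ?fsym_deriv_flin; [rewrite /fconst; ring | exact: fsym_deriv_derivation].
under eq_bigr do rewrite E mulr_suml; rewrite exchange_big /=; apply: eq_bigr => a _.
under eq_bigr do rewrite mulr_suml; rewrite exchange_big /=; apply: eq_bigr => b _.
rewrite (vec_coordE _ _ (memv_pi k m _)) mulr_sumr; apply: eq_bigr => c _.
by rewrite mulrA.
Qed.

Lemma br_r_splitting p q s : br (row p r) (row q r) 0 s =
  \sum_a \sum_b Q p a * Q q b * vec k (lie (em a) (em b)) 0 s.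
Proof.
rewrite !row_r_splitting br_suml summxE; apply: eq_bigr => a _.
rewrite br_sumr summxE; apply: eq_bigr => b _.
by rewrite brZl brZr br_vec scalerA [LHS]mxE.
Qed.

Lemma em_mem (b : 'I_(\dim m)) : em b \in m.
Proof. exact: vbasis_tuple_mem. Qed.

Lemma lie_em_mem (a b : 'I_(\dim m)) : lie (em a) (em b) \in (k + m)%VS.
Proof. by rewrite klm; apply: lsub; apply: (memm_l klm); apply: em_mem. Qed.

(** The [k]-component of the Jacobi identity. The inner projection to [m] is harmless, since
    bracketing [m] with [k] lands in [m]. *)
Lemma flin_cyclic (a b d : 'I_(\dim m)) :
  flin k (pk (lie (em d) (pm (lie (em a) (em b)))))
  + flin k (pk (lie (em a) (pm (lie (em b) (em d)))))
  + flin k (pk (lie (em b) (pm (lie (em d) (em a))))) = 0.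
Proof.
have E (e e' e'' : 'I_(\dim m)) : pk (lie (em e) (pm (lie (em e') (em e'')))) =
    pk (lie (em e) (lie (em e') (em e''))).
  rewrite -[in RHS](daddv_pi_add km0 (lie_em_mem e' e'')) lieDr linearD /=.
  have xm := lie_stable_mk kmm (em_mem e) (memv_pi k m (lie (em e') (em e''))).
  by rewrite (memm_split km0 xm).1 add0r.
by rewrite !E -!flinD -!linearD lie_jacobi linear0 flin0.
Qed.

(** Expresses the third tensor leg through [Q] as well, so that all three legs carry the same kind
    of coefficient and can be permuted. *)
Lemma vec_mem_m z s : z \in m ->
  vec k z 0 s = \sum_d Q s d * (flin k (pk (lie (em d) z)))%:F.
Proof.
move=> zm; rewrite (vec_coordE _ _ zm).
have ME (c : 'I_(\dim m)) : vec k (em c) 0 s = \sum_d Q s d * W d c.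
  by have /matrixP /(_ s c) := mul_inv_omegaK; rewrite mxE => ->; rewrite !mxE.
under eq_bigr do rewrite ME mulr_sumr; rewrite exchange_big /=.
apply: eq_bigr => d _; rewrite {2}(coord_vbasis zm) lie_sumr linear_sum flin_sum.
rewrite rmorph_sum mulr_sumr; apply: eq_bigr => c _.
by rewrite lieZr linearZ flinZ rmorphM [W d c]mxE /fconst; ring.
Qed.

Lemma br_r_splitting_m_cyclic p q s :
  let B p q s := \sum_a \sum_b Q p a * Q q b * vec k (pm (lie (em a) (em b))) 0 s in
  B p q s + B q s p + B s p q = 0.
Proof.
move=> B; pose G d a b := (flin k (pk (lie (em d) (pm (lie (em a) (em b))))))%:F.
have BE p' q' s' : B p' q' s' = \sum_a \sum_b \sum_d Q p' a * Q q' b * Q s' d * G d a b.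
  apply: eq_bigr => a _; apply: eq_bigr => b _.
  rewrite vec_mem_m ?memv_pi // mulr_sumr; apply: eq_bigr => d _.
  by rewrite mulrA.
have -> : B q s p = \sum_a \sum_b \sum_d Q p a * Q q b * Q s d * G a b d.
  rewrite BE; under eq_bigr do rewrite exchange_big /=.
  rewrite exchange_big; apply: eq_bigr => a _; apply: eq_bigr => b _.
  by apply: eq_bigr => d _; ring.
have -> : B s p q = \sum_a \sum_b \sum_d Q p a * Q q b * Q s d * G b d a.
  rewrite BE exchange_big; apply: eq_bigr => a _ /=.
  rewrite exchange_big; apply: eq_bigr => b _.
  by apply: eq_bigr => d _; ring.
rewrite BE -!big_split big1 // => a _; rewrite -!big_split big1 // => b _.
rewrite -!big_split big1 // => d _ /=.
have G0 : G d a b + G a b d + G b d a = 0 by rewrite /G -!tofracD flin_cyclic tofrac0.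
by rewrite -!mulrDr G0 mulr0.
Qed.

(** The derivative term equals the [k]-part of the bracket before any cyclic sum; only the [m]-part
    needs cyclic summation. *)
Lemma CYB_r_splitting p q s :
  let B p q s := br (row p r) (row q r) 0 s
     - \sum_c frac_der (fsym_deriv c) (r p q) * vec k (ek c) 0 s in
  B p q s + B q s p + B s p q = 0.
Proof.
move=> B; rewrite -[RHS](br_r_splitting_m_cyclic p q s).
have E p' q' s' : B p' q' s' =
    \sum_a \sum_b Q p' a * Q q' b * vec k (pm (lie (em a) (em b))) 0 s'.
  rewrite /B br_r_splitting dtens_r_splitting -sumrB; apply: eq_bigr => a _; rewrite -sumrB.
  apply: eq_bigr => b _; rewrite -mulrBr; congr (_ * _).
  rewrite -{1}(daddv_pi_add km0 (lie_em_mem a b)) vecD [X in X - _]mxE.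
  by rewrite addrAC subrr add0r.
by rewrite !E.
Qed.

(** With [C] the matrix of [ad x] on [m], the variation of [P] has two terms, which cancel the
    action of [ad x] on the two legs of [r]. *)
Lemma r_splitting_invariant x : x \in k ->
  map_mx (frac_der (fad k x)) r + (ad_mx k x)^T *m r + r *m ad_mx k x = 0.
Proof.
move=> xk.
pose C : 'M[K]_(\dim m) := map_mx tofrac
  (\matrix_(b, a) fsym_of (coord (vbasis m) b (lie x (em a)))%:MP).
have DW : map_mx (frac_der (fad k x)) W = C^T *m W + W *m C.
  have -> : map_mx (frac_der (fad k x)) W = map_mx tofrac (map_mx (fad k x) (omega_on k m k)).
    apply/matrixP => a b; rewrite !mxE frac_der_tofrac //; exact: fad_derivation.
  rewrite (fad_omega klm km0 kmm lsub ksub xk) map_mxD !map_mxM omega_mxE -map_trmx.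
  by [].
have MC : M *m ad_mx k x = C^T *m M.
  apply/row_matrixP => a; rewrite row_mul.
  have -> : row a M = vec k (em a) by apply/rowP => p; rewrite !mxE.
  have xa : lie x (em a) \in m by apply: kmm => //; apply: vbasis_tuple_mem.
  rewrite mul_ad_mx br_vec (vec_coord _ xa); apply/rowP => p; rewrite summxE !mxE.
  by apply: eq_bigr => b _; rewrite !mxE.
have WQ : W *m Q^T = - M.
  have : (Q *m W)^T = M by rewrite mul_inv_omegaK trmxK.
  by rewrite trmx_mul omega_mx_anti mulNmx => e; rewrite -[LHS]opprK e.
have rA : r *m ad_mx k x = Q *m C^T *m M by rewrite r_splittingE -(mulmxA Q M) MC mulmxA.
have -> : (ad_mx k x)^T *m r = - (M^T *m C *m Q^T).
  rewrite -[r]trmxK -trmx_mul r_splitting_anti mulNmx linearN /= rA.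
  by rewrite (trmx_mul _ M) (trmx_mul Q) trmxK mulmxA.
have e1 : Q *m (C^T *m W) *m Q^T = - (Q *m C^T *m M).
  by rewrite (mulmxA Q) -(mulmxA _ W) WQ mulmxN.
have e2 : Q *m (W *m C) *m Q^T = M^T *m C *m Q^T by rewrite (mulmxA Q W) mul_inv_omegaK.
rewrite rA (der_r_splitting (fad_derivation k x) (fad_cst k x)) DW mulmxDr mulmxDl e1 e2.
by rewrite addrK addNr.
Qed.

End SplittingRMatrix.

(** * The restricted r-matrix *)

Section Localization.
Context {A : idomainType}.

Definition localized (d : A) (x : {fraction A}) := exists a n, x = a%:F / (d ^+ n)%:F.

Lemma localized_tofrac d a : localized d a%:F.
Proof. by exists a, 0; rewrite expr0 tofrac1 divr1. Qed.

Lemma localizedM d x y : localized d x -> localized d y -> localized d (x * y).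
Proof.
move=> [a [n ->]] [b [p ->]]; exists (a * b), (n + p)%N.
by rewrite mulf_div -!tofracM exprD.
Qed.

Lemma localizedD d x y : d != 0 -> localized d x -> localized d y -> localized d (x + y).
Proof.
move=> d0 [a [n ->]] [b [p ->]]; exists (a * d ^+ p + b * d ^+ n), (n + p)%N.
by rewrite addf_div ?tofrac_eq0 ?expf_neq0 // -!tofracM -tofracD exprD.
Qed.

Lemma localized_sum d (I : Type) (r : seq I) (P : pred I) (f : I -> {fraction A}) :
  d != 0 -> (forall i, P i -> localized d (f i)) ->
  localized d (\sum_(i <- r | P i) f i).
Proof.
move=> d0 fP; elim/big_ind: _ => [|x y|//]; last exact: localizedD.
by have := localized_tofrac d 0; rewrite tofrac0.
Qed.

Lemma localized_mulr d e x : e != 0 -> localized d x -> localized (d * e) x.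
Proof.
move=> e0 [a [n ->]]; exists (a * e ^+ n), n.
by rewrite exprMn !tofracM invfM mulrACA divff ?mulr1 // tofrac_eq0 expf_neq0.
Qed.

End Localization.

Section RestrictedRMatrix.
Context {F : fieldType} {g : lieAlgType F} (l k m : {vspace g}).
Hypothesis F0 : [pchar F] =i pred0.
Hypotheses (klm : (k + m = l)%VS) (km0 : (k :&: m = 0)%VS).
Hypotheses (lsub : lie_subalgebra l) (ksub : lie_subalgebra k).
Hypotheses (kmm : lie_stable k m m) (domega : \det (omega_on k m k) != 0).

Local Notation N := (\dim {:g}).
Local Notation K := {fraction (ffunc k)}.
Local Notation pk := (daddv_pi k m).
Local Notation pm := (daddv_pi m k).
Local Notation em b := ((vbasis m)`_b).
Local Notation ek c := ((vbasis k)`_c).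
Local Notation el a := ((vbasis l)`_a).
Local Notation W := (omega_mx k m).
Local Notation Q := ((mvec k m)^T *m invmx W).
Local Notation r := (r_splitting k m).
Local Notation phi := (fres l k m).

Variables (Z : tensor3 g F) (rho : 'M[{fraction (ffunc l)}]_N).
Hypothesis rhoP : is_rmatrix l Z rho.

Local Notation tau := (restrict l k m rho).
(** Derivatives on the dual of [l], restricted afterwards; the transverse ones are not derivatives
    of [tau]. *)
Local Notation y a p q := (frac_map phi (frac_der (fsym_deriv a) (rho p q))).

Lemma rho_anti : rho^T = - rho.
Proof. by case: rhoP => -[]. Qed.

(** The denominator is a power of [Delta], which survives restriction by invariance of its zero
    locus; [frac_map] thus avoids its default value. *)
Lemma specializes_tau p q : specializes phi (rho p q) (tau p q).
Proof.
case: rhoP => -[_ [Delta [D0 inv rhoD]]] _ _.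
have pD := fres_zero_locus F0 klm km0 domega lsub D0 inv.
have [a [n e]] := rhoD p q; rewrite mxE e.
have pDn : phi (Delta ^+ n) != 0 by rewrite rmorphXn expf_neq0.
by rewrite frac_mapE //; exists a, (Delta ^+ n).
Qed.

Lemma specializes_deriv_rho a p q : specializes phi (frac_der (fsym_deriv a) (rho p q)) (y a p q).
Proof.
exact: specializes_der_exists (fsym_deriv_derivation a) (specializes_tau p q).
Qed.

Lemma specializes_fconst c : specializes phi (fconst l c) (fconst k c).
Proof. by have := specializes_tofrac (fres l k m) (fsym_of c%:MP); rewrite /= fres_cst. Qed.

Lemma specializes_vec x p : specializes phi (vec l x 0 p) (vec k x 0 p).
Proof. by rewrite !mxE; apply: specializes_fconst. Qed.

Lemma tau_anti : tau^T = - tau.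
Proof.
apply/matrixP => p q; rewrite mxE [RHS]mxE.
apply: (specializes_unique (phi := fres l k m)) (specializes_tau q p) _.
have -> : rho q p = - rho p q by have /matrixP /(_ p q) := rho_anti; rewrite !mxE.
exact/specializesN/specializes_tau.
Qed.

Lemma specializes_br p q s :
  specializes phi (br (row p rho) (row q rho) 0 s) (br (row p tau) (row q tau) 0 s).
Proof.
rewrite !mxE; apply: specializes_sum => i _; apply: specializes_sum => j _.
apply: specializesM; last exact: specializes_vec.
by apply: specializesM; rewrite [X in specializes _ X _]mxE [X in specializes _ _ X]mxE; apply: specializes_tau.
Qed.

Lemma restricted_CYB p q s :
  let B p q s := br (row p tau) (row q tau) 0 s - \sum_(a < \dim l) y a p q * vec k (el a) 0 s in
  B p q s + B q s p + B s p q = fconst k (Z (p, q, s)).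
Proof.
move=> B.
have E p' q' s' : specializes phi (br (row p' rho) (row q' rho) 0 s' - dtens rho (p', q', s')) (B p' q' s').
  apply: specializesD; first exact: specializes_br.
  apply: specializesN; rewrite dtens_coord; apply: specializes_sum => a _.
  by apply: specializesM; [exact: specializes_deriv_rho | exact: specializes_vec].
apply: specializes_unique (specializes_fconst (Z (p, q, s))).
case: rhoP => _ _ /(congr1 (fun t : tensor3 g _ => t (p, q, s))).
rewrite 2!ffunE [ext3 _ _ _]ffunE AltE CYB_coord ?rho_anti // => <-.
rewrite (_ : _ - _ = br (row p rho) (row q rho) 0 s - dtens rho (p, q, s)
   + (br (row q rho) (row s rho) 0 p - dtens rho (q, s, p))
   + (br (row s rho) (row p rho) 0 q - dtens rho (s, p, q))); last by ring.
by apply: specializesD; [apply: specializesD; exact: (E _ _ _) | exact: (E _ _ _)].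
Qed.

Lemma tau_deriv c p q : frac_der (fsym_deriv c) (tau p q) =
  \sum_(a < \dim l) fconst k (coord (vbasis k) c (pk (el a))) * y a p q.
Proof.
pose Dk : ffunc l -> ffunc l := fdir (fun a : 'I_(\dim l) => coord (vbasis k) c (pk (el a))).
have derDk : derivation Dk by apply: fdir_derivation.
have H1 : specializes phi (frac_der Dk (rho p q)) (frac_der (fsym_deriv c) (tau p q)).
  apply: specializes_der (specializes_tau p q) => //; first exact: fsym_deriv_derivation.
  by move=> f; rewrite /= -fsym_deriv_fres.
apply: specializes_unique H1 _.
rewrite (frac_der_lincomb _ derDk (fun i => fsym_deriv_derivation i) (fun a => erefl)).
apply: specializes_sum => a _; apply: specializesM; last exact: specializes_deriv_rho.
exact: specializes_fconst.
Qed.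

(** Taken for all [x] in [l]: [k] will give the invariance of [tau], and [m] a linear system for the
    transverse derivatives. *)
Lemma tau_equivariant x p q : x \in l ->
  \sum_(a < \dim l) (flin k (pk (lie x (el a))))%:F * y a p q
  + ((ad_mx k x)^T *m tau) p q + (tau *m ad_mx k x) p q = 0.
Proof.
move=> xl; have [_ /invariant_functionP /(_ x xl) /matrixP /(_ p q) inv _] := rhoP.
apply: (specializes_unique (phi := fres l k m)) _ (specializes0 _).
have -> : 0 = frac_der (fad l x) (rho p q) + ((ad_mx l x)^T *m rho) p q + (rho *m ad_mx l x) p q.
  by move: inv; rewrite !mxE.
apply: specializesD; [apply: specializesD|].
- rewrite (frac_der_lincomb _ (fad_derivation l x) (fun i => fsym_deriv_derivation i) (fun a => erefl)).
  apply: specializes_sum => a _; apply: specializesM; last exact: specializes_deriv_rho.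
  have xa : lie x (el a) \in l by apply: lsub => //; apply: vbasis_tuple_mem.
  by rewrite -(fres_flin k m xa); apply: (specializes_tofrac (fres l k m)).
- rewrite [X in specializes _ X _]mxE [X in specializes _ _ X]mxE; apply: specializes_sum => i _.
  apply: specializesM; last exact: specializes_tau.
  rewrite ![_^T _ _]mxE ![ad_mx _ _ _ _]mxE; exact: specializes_vec.
- rewrite [X in specializes _ X _]mxE [X in specializes _ _ X]mxE; apply: specializes_sum => i _.
  apply: specializesM; first exact: specializes_tau.
  rewrite ![ad_mx _ _ _ _]mxE; exact: specializes_vec.
Qed.

Lemma tau_invariant x : x \in k ->
  map_mx (frac_der (fad k x)) tau + (ad_mx k x)^T *m tau + tau *m ad_mx k x = 0.
Proof.
move=> xk; apply/matrixP => p q; rewrite [RHS]mxE -[RHS](tau_equivariant p q (memk_l klm xk)) 2!mxE.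
congr (_ + _ + _); rewrite mxE.
have derk c := fsym_deriv_derivation c : derivation (fsym_deriv c : ffunc k -> ffunc k).
rewrite (frac_der_lincomb _ (fad_derivation k x) derk (fun a => erefl)).
under eq_bigr do rewrite tau_deriv mulr_sumr; rewrite exchange_big; apply: eq_bigr => a _ /=.
have ea : el a \in (k + m)%VS by rewrite klm vbasis_tuple_mem.
have -> : pk (lie x (el a)) = lie x (pk (el a)).
  rewrite -{1}(daddv_pi_add km0 ea) lieDr linearD /=.
  rewrite (memk_split km0 (ksub xk (memv_pi _ _ _))).1.
  by rewrite (memm_split km0 (kmm xk (memv_pi _ _ _))).1 addr0.
rewrite [in RHS](coord_vbasis (memv_pi k m (el a))) lie_sumr flin_sum rmorph_sum mulr_suml.
by apply: eq_bigr => c _; rewrite lieZr flinZ rmorphM /fconst /=; ring.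
Qed.

Local Notation Y b p q := (\sum_(a < \dim l) fconst k (coord (vbasis m) b (pm (el a))) * y a p q).

Lemma omega_transverse_deriv d p q : \sum_(b < \dim m) W d b * Y b p q =
  br (vec k (em d)) (row q tau) 0 p - br (vec k (em d)) (row p tau) 0 q.
Proof.
have mE (b : 'I_(\dim m)) : em b \in m by apply: vbasis_tuple_mem.
have /eqP := tau_equivariant p q (memm_l klm (mE d)); rewrite -addrA addr_eq0 => /eqP e.
transitivity (\sum_(a < \dim l) (flin k (pk (lie (em d) (el a))))%:F * y a p q).
  under eq_bigr do rewrite mulr_sumr; rewrite exchange_big; apply: eq_bigr => a _ /=.
  have ea : el a \in (k + m)%VS by rewrite klm vbasis_tuple_mem.
  (* The [k]-component of the basis vector drops out, so only transverse derivatives remain, with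
     coefficient matrix [W]. *)
  have -> : pk (lie (em d) (el a)) = pk (lie (em d) (pm (el a))).
    rewrite -{1}(daddv_pi_add km0 ea) lieDr linearD /=.
    by rewrite (memm_split km0 (lie_stable_mk kmm (mE d) (memv_pi _ _ _))).1 add0r.
  rewrite [in RHS](coord_vbasis (memv_pi m k (el a))) lie_sumr linear_sum flin_sum.
  rewrite rmorph_sum mulr_suml; apply: eq_bigr => b _.
  by rewrite lieZr linearZ flinZ rmorphM [W d b]mxE /fconst /=; ring.
rewrite e opprD; congr (_ - _).
  have -> : (ad_mx k (em d))^T *m tau = - (tau *m ad_mx k (em d))^T.
    by rewrite trmx_mul tau_anti mulmxN opprK.
  by rewrite mxE mxE opprK -mul_ad_mx -row_mul [RHS]mxE.
by rewrite -mul_ad_mx -row_mul [RHS]mxE.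
Qed.

(** Writing [e_b] as the combination of columns of [W] given by [Q] brings in the system just
    obtained; its right-hand sides assemble into brackets with row [s] of [r]. *)
Lemma restricted_dtens_split p q s : \sum_(a < \dim l) y a p q * vec k (el a) 0 s =
  \sum_(c < \dim k) frac_der (fsym_deriv c) (tau p q) * vec k (ek c) 0 s
  + (br (row s r) (row q tau) 0 p - br (row s r) (row p tau) 0 q).
Proof.
have -> : br (row s r) (row q tau) 0 p - br (row s r) (row p tau) 0 q =
    \sum_(b < \dim m) Y b p q * vec k (em b) 0 s.
  rewrite !(row_r_splitting domega) !br_suml !summxE -sumrB.
  have ME (b : 'I_(\dim m)) : vec k (em b) 0 s = \sum_(d < \dim m) Q s d * W d b.
    by have /matrixP /(_ s b) := mul_inv_omegaK domega; rewrite mxE => ->; rewrite !mxE.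
  under [RHS]eq_bigr do rewrite ME mulr_sumr; rewrite exchange_big /=.
  apply: eq_bigr => d _; rewrite !brZl ![(_ *: _ : 'rV_N) _ _]mxE -mulrBr -omega_transverse_deriv mulr_sumr.
  by apply: eq_bigr => b _; ring.
under [X in _ = X + _]eq_bigr do rewrite tau_deriv mulr_suml.
under [X in _ = _ + X]eq_bigr do rewrite mulr_suml.
rewrite exchange_big [X in _ = _ + X]exchange_big -big_split; apply: eq_bigr => a _ /=.
have ea : el a \in (k + m)%VS by rewrite klm vbasis_tuple_mem.
rewrite -{1}(daddv_pi_add km0 ea) vecD mxE !(vec_coordE _ _ (memv_pi _ _ _)).
rewrite mulrDr !mulr_sumr; congr (_ + _); apply: eq_bigr => c _; ring.
Qed.

Lemma sigma_wedge2 : wedge2_function (sigma l k m rho).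
Proof.
split; first by rewrite linearD /= r_splitting_anti // tau_anti opprD.
have [[_ [Delta [D0 inv rhoD]]] _ _] := rhoP.
have pD := fres_zero_locus F0 klm km0 domega lsub D0 inv.
have dD := mulf_neq0 domega pD.
(* A product works because the radical of a product is the intersection of the radicals, so
   stability can be checked on each factor. *)
exists (\det (omega_on k m k) * phi Delta); split=> //.
  move=> x xk f /radical_prod [f1 f2]; apply/radical_prod; split.
    exact: (zero_locus_det_omega F0 klm km0 kmm lsub ksub xk).
  exact: (zero_locus_fres F0 klm km0 kmm ksub inv xk).
move=> i j; rewrite mxE; apply: localizedD => //; last first.
  have [a [n e]] := rhoD i j; rewrite mxE e mulrC; apply: localized_mulr => //.
  have pDn : phi (Delta ^+ n) != 0 by rewrite rmorphXn expf_neq0.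
  by exists (phi a), n; rewrite frac_mapE // rmorphXn.
apply: localized_mulr => //; rewrite r_splittingE //.
have loc_vec x p : localized (\det (omega_on k m k)) (vec k x 0 p).
  by rewrite mxE; apply: localized_tofrac.
rewrite mxE; apply: localized_sum => // b _; apply: localizedM; last by rewrite mxE.
rewrite mxE; apply: localized_sum => // a _; apply: localizedM; first by rewrite mxE mxE.
(* The inverse is the adjugate over the determinant, so one power of the latter suffices. *)
rewrite /invmx omega_mx_unit // omega_mxE det_map_mx -map_mx_adj mxE [X in _ * X]mxE.
apply: localizedM; last exact: localized_tofrac.
by exists 1, 1; rewrite expr1 tofrac1 mul1r.
Qed.

Lemma sigma_invariant : invariant_function (sigma l k m rho).
Proof.
apply/invariant_functionP => x xk; rewrite /sigma.
move: (tau_invariant xk) (r_splitting_invariant klm km0 lsub ksub kmm domega xk).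
have := derD_add (frac_der_derivation (fad_derivation k x)).
move: (frac_der (fad k x)) (r) (tau) (ad_mx k x) => D u v A DD e1 e2.
have -> : map_mx D (u + v) = map_mx D u + map_mx D v.
  by apply/matrixP => i j; rewrite !mxE DD.
have -> : (u + v) *m A = u *m A + v *m A by apply: mulmxDl.
have -> : A^T *m (u + v) = A^T *m u + A^T *m v by apply: mulmxDr.
by rewrite (addrACA (map_mx D u)) (addrACA (map_mx D u + A^T *m u)) e1 e2 addr0.
Qed.

Lemma sigma_CYB : CYB (sigma l k m rho) - Alt (dtens (sigma l k m rho)) = ext3 k Z.
Proof.
have [santi _] := sigma_wedge2.
apply/ffunP => -[[p q] s]; rewrite 2!ffunE [ext3 _ _ _]ffunE AltE CYB_coord //.
rewrite -(restricted_CYB p q s) -[RHS]addr0 -[X in _ = _ + X](CYB_r_splitting klm km0 lsub kmm domega p q s).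
have dE p' q' s' : dtens (sigma l k m rho) (p', q', s') =
   \sum_(c < \dim k) frac_der (fsym_deriv c) (r p' q') * vec k (ek c) 0 s'
   + \sum_(c < \dim k) frac_der (fsym_deriv c) (tau p' q') * vec k (ek c) 0 s'.
  rewrite dtens_coord -big_split; apply: eq_bigr => c _.
  by rewrite mxE (derD_add (frac_der_derivation (fsym_deriv_derivation c))) mulrDl.
have bE p' q' s' : br (row p' (sigma l k m rho)) (row q' (sigma l k m rho)) 0 s' =
    br (row p' r) (row q' r) 0 s' + br (row p' r) (row q' tau) 0 s'
    + br (row p' tau) (row q' r) 0 s' + br (row p' tau) (row q' tau) 0 s'.
  by rewrite !linearD /= brDl !brDr !mxE; ring.
cbv beta zeta; rewrite !restricted_dtens_split !dE !bE.
(* Once each mixed bracket has its [r] row first, the mixed terms agree with the transverse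
   derivative terms after a cyclic shift of [p, q, s]; they match only in the full cyclic sum. *)
have anti (u v : 'rV[K]_N) i : br u v 0 i = - br v u 0 i by rewrite br_anti mxE.
rewrite (anti (row p tau) (row q r)) (anti (row q tau) (row s r)) (anti (row s tau) (row p r)).
ring.
Qed.

End RestrictedRMatrix.

Theorem proposition0p1 (R : realType) (g : lieAlgType R[i])
    (l k m : {vspace g}) (Z : tensor3 g R[i])
    (hl : lie_subalgebra l)
    (hlkm : nondegenerate_splitting l k m)
    (hZ : wedge3_invariant Z)
    (rho : 'M[{fraction (ffunc l)}]_(\dim {:g})) :
  is_rmatrix l Z rho -> is_rmatrix k Z (sigma l k m rho).
Proof.
move=> rhoP; have F0 : [pchar R[i]] =i pred0 := Num.Theory.pchar_num _.
have domega := det_omega_neq0 F0 hlkm.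
have [klm km0 ksub kmm _] := hlkm; split.
- exact: (sigma_wedge2 F0 klm km0 hl ksub kmm domega rhoP).
- exact: (sigma_invariant F0 klm km0 hl ksub kmm domega rhoP).
- exact: (sigma_CYB F0 klm km0 hl ksub kmm domega rhoP).
Qed.
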